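(* Let $\sigma=(\sigma_j)_{j\in\mathbb N}\in\ell_2$ be a non-increasing sequence of non-negative real numbers and let $n\in\mathbb N$. Let $A_n$ be the least squares algorithm with parameter $k=\lfloor n/2\rfloor$. Then with probability at least $1-2\exp(-n/100)$ it holds that $$\mathcal R_n(\sigma)\,\le\, e(A_n)\,\le\,\frac{221}{\sqrt n}\Big(\sum_{j\ge\lfloor n/4\rfloor}\sigma_j^2\Big)^{1/2}.$$
   Context: Convention: $a/0=\infty$ for $a>0$ and $0/0=0$. Put $H_\sigma=\{x\in\ell_2:\sum_{j\in\mathbb N}(x_j/\sigma_j)^2<\infty\}$ and $\mathcal E_\sigma=\{x\in\ell_2:\sum_{j\in\mathbb N}(x_j/\sigma_j)^2\le 1\}$. $G_n=(g_{ij})_{1\le i\le n,\,j\in\mathbb N}$ is a random matrix with independent standard Gaussian entries, and $G_nx=(\sum_{j}g_{ij}x_j)_{i=1}^n$, where a component is assigned the value NaN if its series does not converge (for $\sigma\in\ell_2$, almost surely all these series converge for all $x\in H_\sigma$). The radius of random information is $$\mathcal R_n(\sigma)=\inf_{\phi}\ \sup_{x\in\mathcal E_\sigma}\|\phi(G_nx)-x\|_2,$$ the infimum being over all mappings $\phi$ from the image of $G_n$ (on $H_\sigma$) to $\ell_2$. Least squares algorithm with parameter $k\le n$: identify $\mathbb R^k$ with $\{x\in\ell_2: x_j=0\text{ for all }j>k\}$, let $\psi=(g_{ij})_{1\le i\le n,1\le j\le k}\in\mathbb R^{n\times k}$ be the restriction of $G_n$ to $\mathbb R^k$, let $\psi^+$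 be its Moore–Penrose inverse, and set $A_n(x)=\psi^+(G_nx)\in\mathbb R^k\subset\ell_2$ (so $A_n=0$ if $k=0$). Its worst case error is $e(A_n)=\sup_{x\in\mathcal E_\sigma}\|A_n(x)-x\|_2$. Sums over $j$ run over positive integers $j$ satisfying the indicated condition. *)

(* Defs.v *)
From HB Require Import structures.
From mathcomp Require Import all_boot all_order all_algebra.
From mathcomp Require Import finmap.
From mathcomp Require Import all_classical all_reals all_analysis.
Import Order.TTheory GRing.Theory Num.Theory.
Import numFieldNormedType.Exports.

Set Implicit Arguments.
Unset Strict Implicit.
Unset Printing Implicit Defensive.

Local Open Scope classical_set_scope.
Local Open Scope ring_scope.

(* Sequences are indexed from 0: the entry at [j : nat] is the mathematical
   entry of index [j + 1]. *)

Section RandomMatrix.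
Context d (T : measurableType d) (R : realType) (P : probability T R).

Definition mutually_independent (I : choiceType) (X : I -> {RV P >-> R}) :=
  forall (J : {fset I}) (B : I -> set R), (forall i, measurable (B i)) ->
    P (\bigcap_(i in [set` J]) (X i @^-1` B i)) =
    (\prod_(i <- J) P (X i @^-1` B i))%E.

Definition standard_gaussian (X : {RV P >-> R}) :=
  forall B : set R, measurable B -> distribution P X B = normal_prob 0 1 B.

Definition gaussian_matrix n (g : 'I_n -> nat -> {RV P >-> R}) :=
  mutually_independent (fun ij : 'I_n * nat => g ij.1 ij.2) /\
  forall i j, standard_gaussian (g i j).

End RandomMatrix.

Section MoorePenrose.
Variable R : realType.

Definition penrose m n (A : 'M[R]_(m, n)) (B : 'M[R]_(n, m)) :=
  [/\ A *m B *m A = A, B *m A *m B = B,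
      (A *m B)^T = A *m B & (B *m A)^T = B *m A].

Definition mp_inverse m n (A : 'M[R]_(m, n)) : 'M[R]_(n, m) :=
  xget 0 [set B | penrose A B].

Lemma penrose_uniq m n (A : 'M[R]_(m, n)) B C :
  penrose A B -> penrose A C -> B = C.
Proof.
move=> [ABA BAB ABt BAt] [ACA CAC ACt CAt].
have AB_AC : A *m B = A *m C.
  by rewrite -ABt -{1}ACA -mulmxA trmx_mul ABt ACt mulmxA ABA.
have BA_CA : B *m A = C *m A.
  by rewrite -BAt -{1}ACA mulmxA mulmxA -(mulmxA (B *m A)) trmx_mul BAt CAt
             -mulmxA (mulmxA A) ABA.
by rewrite -BAB BA_CA -mulmxA AB_AC mulmxA CAC.
Qed.

Lemma row_free_gram m n (A : 'M[R]_(m, n)) :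
  row_free A -> A *m A^T \in unitmx.
Proof.
move=> Afree; rewrite -row_free_unit -kermx_eq0; apply/rowV0P => v.
move=> /sub_kermxP vAA; apply: (row_free_inj Afree); rewrite mul0mx.
have /matrixP/(_ 0 0) : (v *m A) *m (v *m A)^T = 0.
  by rewrite trmx_mul mulmxA -(mulmxA v) vAA mul0mx.
rewrite !mxE => /psumr_eq0P h; apply/rowP => j; rewrite [RHS]mxE.
have {}h : (v *m A) 0 j * (v *m A)^T j 0 = 0.
  by apply: h => // i _; rewrite [X in _ * X]mxE -expr2 sqr_ge0.
by apply/eqP; move/eqP: h; rewrite [X in _ * X]mxE -expr2 sqrf_eq0.
Qed.

Lemma penrose_exists m n (A : 'M[R]_(m, n)) : exists B, penrose A B.
Proof.
have [r [C [F [<- FF CC]]]] : exists r (C : 'M[R]_(m, r)) (F : 'M[R]_(r, n)),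
    [/\ C *m F = A, F *m F^T \in unitmx & C^T *m C \in unitmx].
  exists (\rank A), (col_base A), (row_base A); split; first exact: mulmx_base.
    by apply: row_free_gram; exact: row_base_free.
  rewrite -[X in _ *m X]trmxK; apply: row_free_gram.
  by rewrite -row_leq_rank mxrank_tr (eqP (col_base_full A)).
pose f := invmx (F *m F^T); pose c := invmx (C^T *m C).
have ft : f^T = f by rewrite trmx_inv trmx_mul trmxK.
have ct : c^T = c by rewrite trmx_inv trmx_mul trmxK.
pose B := F^T *m f *m c *m C^T.
have AB : C *m F *m B = C *m c *m C^T.
  by rewrite /B !mulmxA -(mulmxA C F) -(mulmxA C _ f) mulmxV// mulmx1.
have BA : B *m (C *m F) = F^T *m f *m F.
  by rewrite /B !mulmxA -(mulmxA _ C^T C) -(mulmxA _ c) mulVmx// mulmx1.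
exists B; split.
- by rewrite AB mulmxA -(mulmxA _ C^T) -(mulmxA C) mulVmx// mulmx1.
- rewrite BA /B !mulmxA -(mulmxA _ F F^T) -(mulmxA (F^T *m f) (F *m F^T)).
  by rewrite mulmxV// mulmx1.
- by rewrite AB !trmx_mul trmxK ct mulmxA.
- by rewrite BA !trmx_mul trmxK ft mulmxA.
Qed.

Lemma mp_inverseP m n (A : 'M[R]_(m, n)) : penrose A (mp_inverse A).
Proof. by have [B AB] := penrose_exists A; exact: (xgetPex 0 (ex_intro _ B AB)). Qed.

End MoorePenrose.

Section Recovery.
Variable R : realType.
Implicit Types x sigma : nat -> R.

Definition l2norm x : \bar R := 'N[counting]_(2%:E)[EFin \o x]%E.

Definition ell2 : set (nat -> R) := [set x | finite_norm counting 2%:E x].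

(* Division in [\bar R] satisfies a / 0 = +oo for a > 0, a / 0 = -oo for a < 0,
   and 0 / 0 = 0, so a nonzero [x j] over a zero [sigma j] contributes +oo. *)
Definition weighted_energy sigma x : \bar R :=
  (\sum_(j <oo) ((x j)%:E / (sigma j)%:E) ^+ 2)%E.

Definition Hspace sigma : set (nat -> R) :=
  ell2 `&` [set x | (weighted_energy sigma x < +oo)%E].

Definition ellipsoid sigma : set (nat -> R) :=
  ell2 `&` [set x | (weighted_energy sigma x <= 1)%E].

(* [None] stands for NaN. *)
Definition information n (G : 'I_n -> nat -> R) x : {ffun 'I_n -> option R} :=
  [ffun i => let u := [series G i j * x j]_j in
             if `[< cvgn u >] then Some (limn u) else None].

Definition worst_case_error sigma (A : (nat -> R) -> (nat -> R)) : \bar R :=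
  ereal_sup [set l2norm (A x \- x) | x in ellipsoid sigma].

(* A map from [information G @` Hspace sigma] to [ell2] is represented by a
   total function whose values outside that image are irrelevant. *)
Definition information_radius n sigma (G : 'I_n -> nat -> R) : \bar R :=
  ereal_inf [set worst_case_error sigma (phi \o information G)
            | phi in [set phi : {ffun 'I_n -> option R} -> (nat -> R) |
                forall x, Hspace sigma x -> ell2 (phi (information G x))]].

Definition extend0 k (v : 'cV[R]_k) : nat -> R :=
  fun j => oapp (fun i : 'I_k => v i 0) 0 (insub j).

(* NaN components, which almost surely do not occur on [Hspace sigma] when
   [sigma] is in [ell2], are read as 0. *)
Definition least_squares n k (G : 'I_n -> nat -> R) x : nat -> R :=
  let psi := \matrix_(i < n, j < k) G i j in
  extend0 (mp_inverse psi *m \col_i odflt 0 (information G x i)).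

End Recovery.

(* Main.v *)
(* Write x = (x_1, x_2) with x_1 the first k coordinates, psi for the first k
   columns of G_n and Gamma for the remaining ones scaled by sigma. As soon as
   psi is injective, psi^+ psi = 1, hence A_n(x) - x = psi^+ G_n x_2 - x_2 and
   the error is governed by ||Gamma|| / s_min(psi) and sigma_(k+1). With
   S = sum_(j >= n/4) sigma_j^2, monotonicity gives sigma_(k+1)^2 <= 4 S / n, so
   it suffices that ||Gamma||^2 <= 100 S and s_min(psi)^2 >= n / 420, because
   100 * 420 + 4 <= 221^2. The 1 - 2 exp(-n/100) is trivial unless n >= 50, and
   then three exceptional events of probability exp(-n/50) can be afforded.

   Both norm bounds come from a union bound over the integer points of an l1
   ball. Rounding a vector coordinate by coordinate to an integer point, the
   rounding can be chosen so that a convex quadratic form does not decrease,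
   which bounds ||Gamma|| by its values at integer points, or so that it
   increases by at most a quarter of the trace, which bounds s_min(psi) from
   below once the Frobenius norm of psi is under control. At a fixed integer
   point, Chernoff's bound applies to the exact formula
   E exp(- t (sum_i a_i X_i)^2) = (1 + 2 t sum_i a_i^2)^(-1/2), valid also for
   t < 0 as long as the base is positive; it is proved by integrating out one
   independent Gaussian variable at a time. *)
Require Import Defs.
From HB Require Import structures.
From mathcomp Require Import all_boot all_order all_algebra.
From mathcomp Require Import finmap.
From mathcomp Require Import all_classical all_reals all_analysis.
From mathcomp Require Import measurable_realfun zify ring lra.
Import Order.TTheory GRing.Theory Num.Theory.
Import numFieldNormedType.Exports.

Set Implicit Arguments.
Unset Strict Implicit.
Unset Printing Implicit Defensive.

Local Open Scope classical_set_scope.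
Local Open Scope ring_scope.

(** * Independence of a coordinate from all the others *)

Section Freezing.
Context {d : measure_display} {T : measurableType d} {R : realType}
  (P : probability T R) {I : choiceType} (X : I -> {RV P >-> R}).
Hypothesis indepX : mutually_independent X.

(** A pi-system that generates the sigma-algebra of all coordinates other than [l]. *)
Definition cylinders_away (l : I) : set (set T) :=
  [set A | exists (J : {fset I}) (B : I -> set R),
    [/\ l \notin J, (forall i, measurable (B i)) &
        A = \bigcap_(i in [set` J]) (X i @^-1` B i)]].

Lemma RV_preimage_measurable i (B : set R) :
  measurable B -> measurable (X i @^-1` B).
Proof. by move=> mB; rewrite -[_ @^-1` _]setTI; exact: measurable_funP. Qed.

Lemma cylinders_away_measurable l : cylinders_away l `<=` measurable.
Proof.
move=> _ [J [B [_ mB ->]]].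
apply: fin_bigcap_measurable => [|i _]; first exact: finite_fset.
exact: RV_preimage_measurable.
Qed.

Lemma cylinders_away_setI l : setI_closed (cylinders_away l).
Proof.
move=> _ _ [J [B [lJ mB ->]]] [J' [B' [lJ' mB' ->]]].
(* Padding each family with [setT] outside its own index set lets both be read over the union. *)
pose C (J0 : {fset I}) (B0 : I -> set R) i := if i \in J0 then B0 i else setT.
exists (J `|` J')%fset, (fun i => C J B i `&` C J' B' i); split.
- by rewrite in_fsetU negb_or lJ.
- by move=> i; apply: measurableI; rewrite /C; case: ifP.
- apply/seteqP; split => [w [/= Jw J'w] i _|w /= JJ'w].
    by split; rewrite /C; case: ifP => // iJ; [exact: Jw|exact: J'w].
  split=> i /= iJ.
    by have := JJ'w i; rewrite /= in_fsetU iJ => /(_ isT) []; rewrite /C iJ.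
  have := JJ'w i; rewrite /= in_fsetU iJ orbT => /(_ isT) [_].
  by rewrite /C iJ.
Qed.

Lemma cylinders_awayT l : cylinders_away l setT.
Proof.
exists fset0, (fun=> setT); split=> //.
by rewrite set_fset0 bigcap_set0.
Qed.

Lemma cylinders_away_RV l i : i != l ->
  forall B, measurable B -> cylinders_away l (X i @^-1` B).
Proof.
move=> il B mB; exists [fset i]%fset, (fun=> B); split=> //.
  by rewrite in_fset1 eq_sym.
by rewrite set_fset1 bigcap_set1.
Qed.

Lemma cylinders_away_indep l A B : measurable B -> cylinders_away l A ->
  P (A `&` X l @^-1` B) = (P A * P (X l @^-1` B))%E.
Proof.
move=> mB [J [C [lJ mC ->]]].
pose D i := if i == l then B else C i.
have mD i : measurable (D i) by rewrite /D; case: ifP.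
have DJ i : i \in J -> D i = C i.
  by move=> iJ; rewrite /D; case: eqP => // il; rewrite -il iJ in lJ.
have -> : \bigcap_(i in [set` J]) (X i @^-1` C i) `&` X l @^-1` B =
          \bigcap_(i in [set` (l |` J)%fset]) (X i @^-1` D i).
  apply/seteqP; split => [w [/= Jw lw] i|w /= lJw].
    rewrite /= in_fset1U => /orP[/eqP -> /=|iJ /=]; first by rewrite /D eqxx.
    by rewrite DJ//; exact: Jw.
  split; last by have := lJw l; rewrite /= fset1U1 /D eqxx; exact.
  by move=> i /= iJ; have := lJw i; rewrite /= fset1Ur// DJ//; exact.
rewrite indepX// indepX//.
have -> : (\prod_(i <- (l |` J)%fset) P (X i @^-1` D i) =
          P (X l @^-1` D l) * \prod_(i <- J) P (X i @^-1` D i))%E.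
  by rewrite big_fsetU1.
rewrite muleC {2}/D eqxx; congr (_ * _)%E.
by apply: eq_big_seq => i iJ; rewrite DJ.
Qed.

(** Intersecting with the event on [X l] and scaling by its probability give two finite measures
    that agree on a pi-system, hence on the sigma-algebra it generates. *)
Lemma sigma_away_indep l A B : measurable B -> <<s cylinders_away l >> A ->
  P (A `&` X l @^-1` B) = (P A * P (X l @^-1` B))%E.
Proof.
move=> mB sA; pose D := X l @^-1` B.
have mD : measurable D by exact: RV_preimage_measurable.
have PD0 : 0 <= fine (P D) by rewrite fine_ge0.
have PDE : (fine (P D))%:E = P D by rewrite fineK// fin_num_measure.
pose m2 : {measure set T -> \bar R} := mscale (NngNum PD0) P.
have := @g_sigma_algebra_measure_unique _ R T (cylinders_away l)
  (@cylinders_away_measurable l) (fun=> setT) (fun=> cylinders_awayT l) _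
  (mrestr P mD) m2 (@cylinders_away_setI l) _ _ A sA.
have m2E C : m2 C = (P C * P D)%E by rewrite -PDE muleC.
rewrite m2E /= /mrestr; apply.
- by rewrite bigcup_const//; exists 0%N.
- by move=> C cC; rewrite m2E; exact: cylinders_away_indep.
- by move=> _; rewrite setTI (le_lt_trans (probability_le1 P mD))// ltry.
Qed.

End Freezing.

(** * Gaussian integrals and the integration of one independent variable *)

Lemma ge0_integral_normal_prob {R : realType} (m s : R) (f : R -> \bar R) :
  measurable_fun [set: R] f -> (forall x, 0 <= f x)%E ->
  (\int[normal_prob m s]_x f x =
   \int[lebesgue_measure]_x (f x * (normal_pdf m s x)%:E))%E.
Proof.
move=> mf f0; have dom := @normal_prob_dominates R m s.
rewrite -(Radon_Nikodym_SigmaFinite.change_of_variables dom)//.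
have intf := Radon_Nikodym_SigmaFinite.f_integrable dom.
have mpdf : measurable_fun [set: R] (EFin \o normal_pdf m s).
  by apply/measurable_EFinP; exact: measurable_normal_pdf.
apply: ae_eq_integral => //.
- by apply: emeasurable_funM => //; exact: measurable_int intf.
- exact: emeasurable_funM.
(* The Radon-Nikodym derivative and the density have the same integral over every measurable set, so
   they agree almost everywhere. *)
- apply: ae_eqe_mul2l; apply: integral_ae_eq => //= A _ mA.
  by rewrite -(Radon_Nikodym_SigmaFinite.f_integral dom).
Qed.

(** Completing the square: the integrand times the standard density is [K] times the normal density
    of mean [m] and variance [1 / D]. A negative [l] is covered as long as [D] stays positive. *)
Lemma integral_normal_prob_expR_sqr {R : realType} (l a c : R) :
  0 < 1 + 2 * l * a ^+ 2 ->
  (\int[normal_prob 0 1]_x (expR (- (l * (c + a * x) ^+ 2)))%:E =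
   ((Num.sqrt (1 + 2 * l * a ^+ 2))^-1 *
    expR (- (l / (1 + 2 * l * a ^+ 2) * c ^+ 2)))%:E)%E.
Proof.
set D := 1 + _ => D0; have Dn0 : D != 0 by rewrite gt_eqF.
have sD0 : 0 < Num.sqrt D by rewrite sqrtr_gt0.
have sDK : Num.sqrt D ^+ 2 = D by rewrite sqr_sqrtr// ltW.
set K := _ * _; pose s := (Num.sqrt D)^-1; pose m := - (2 * l * a * c / D).
have s0 : s != 0 by rewrite invr_eq0 gt_eqF.
have mexp : measurable_fun [set: R]
    (fun x : R => (expR (- (l * (c + a * x) ^+ 2)))%:E).
  apply/measurable_EFinP; apply: measurableT_comp => //.
  apply: measurableT_comp => //; apply: measurable_funM => //.
  by apply: measurable_funX; apply: measurable_funD => //; exact: measurable_funM.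
rewrite ge0_integral_normal_prob//.
transitivity (\int[lebesgue_measure]_x (K%:E * (normal_pdf m s x)%:E))%E; last first.
  rewrite ge0_integralZl//=; first by rewrite integral_normal_pdf mule1.
  - by apply/measurable_EFinP; exact: measurable_normal_pdf.
  - by move=> x _; rewrite lee_fin normal_pdf_ge0.
  - by rewrite lee_fin mulr_ge0// ?expR_ge0// invr_ge0 ltW.
apply: eq_integral => x _; rewrite -!EFinM; congr EFin.
rewrite !normal_pdfE ?oner_eq0// /normal_peak /normal_fun /K.
have -> : Num.sqrt (s ^+ 2 * pi *+ 2) = s * Num.sqrt (1 ^+ 2 * pi *+ 2).
  rewrite -mulrnAr sqrtrM ?sqr_ge0// sqrtr_sqr ger0_norm ?invr_ge0 ?ltW//.
  by rewrite expr1n mul1r.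
set p := Num.sqrt _; rewrite subr0.
have p0 : p != 0 by rewrite gt_eqF// sqrtr_gt0 expr1n mul1r mulrn_wgt0// pi_gt0.
have expE : expR (- (l * (c + a * x) ^+ 2)) * expR (- x ^+ 2 / (1 ^+ 2 *+ 2)) =
    expR (- (l / D * c ^+ 2)) * expR (- (x - m) ^+ 2 / (s ^+ 2 *+ 2)).
  rewrite -!expRD; congr expR.
  rewrite exprVn sDK expr1n /m; rewrite /D in Dn0 *; field.
  by rewrite Dn0.
rewrite mulrCA expE /s; set e1 := expR _; set e2 := expR _.
by field; rewrite p0 gt_eqF.
Qed.

Lemma measurable_expRN_sqr {d} {T : measurableType d} {R : realType}
    (t : R) (C : T -> R) :
  measurable_fun setT C -> measurable_fun setT (fun w => expR (- (t * C w ^+ 2))).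
Proof.
move=> mC; apply: measurableT_comp => //; apply: measurableT_comp => //.
by apply: measurable_funM => //; exact: measurable_funX.
Qed.

Lemma measurable_fun_affine {R : realType} (c a : R) :
  measurable_fun [set: R] (fun x => c + a * x).
Proof. by apply: measurable_funD => //; exact: measurable_funM. Qed.

Section GaussianFreezing.
Context {d : measure_display} {T : measurableType d} {R : realType}
  (P : probability T R) {I : choiceType} (X : I -> {RV P >-> R}).
Hypothesis indepX : mutually_independent X.
Hypothesis gaussX : forall i, standard_gaussian (X i).

Local Notation away l := (g_sigma_algebraType (cylinders_away X l)).

Lemma away_measurable_fun d' (T' : measurableType d') l (f : T -> T') :
  measurable_fun [set: away l] f -> measurable_fun [set: T] f.
Proof.
move=> mf _ B mB; rewrite setTI; have := mf measurableT B mB; rewrite setTI.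
apply: smallest_sub; first exact: sigma_algebra_measurable.
exact: cylinders_away_measurable.
Qed.

Lemma away_measurable_RV l i : i != l -> measurable_fun [set: away l] (X i).
Proof.
move=> il _ B mB; rewrite setTI; apply: sub_sigma_algebra.
exact: cylinders_away_RV.
Qed.

(** The pair of [w], seen only through the other coordinates, and [X l w] has a product law by
    [sigma_away_indep]; Tonelli then integrates [X l] first. *)
Lemma freeze_independent l (F : away l * R -> \bar R) :
  measurable_fun [set: away l * R] F -> (forall z, 0 <= F z)%E ->
  (\int[P]_w F (w, X l w) = \int[P]_w \int[distribution P (X l)]_x F (w, x))%E.
Proof.
move=> mF F0.
have mid : measurable_fun [set: T] (fun w => w : away l).
  by apply: away_measurable_fun; exact: measurable_id.
have mpair : measurable_fun [set: T] (fun w => (w : away l, X l w)).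
  exact: measurable_fun_pair.
pose idRV : {RV P >-> away l} := HB.pack (fun w => w : away l)
  (isMeasurableFun.Build _ _ _ _ _ mid).
pose pairRV : {RV P >-> (away l * R)%type} := HB.pack
  (fun w => (w : away l, X l w)) (isMeasurableFun.Build _ _ _ _ _ mpair).
pose N := distribution P (X l).
have jointE : forall A : set (away l * R)%type, measurable A ->
    (distribution P idRV \x N)%E A = distribution P pairRV A.
  apply: (@product_measure_unique _ _ _ _ R (distribution P idRV) N
    (distribution P pairRV)) => A B mA mB.
  exact: (sigma_away_indep indepX).
transitivity (\int[distribution P pairRV]_z F z)%E.
  by rewrite ge0_integral_distribution.
transitivity (\int[distribution P idRV \x N]_z F z)%E.
  by apply: eq_measure_integral => A mA _; exact: (esym (jointE A mA)).
rewrite fubini_tonelli1// ge0_integral_distribution//.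
- rewrite -[X in measurable_fun _ X]/(fubini_F _ F).
  exact: measurable_fun_fubini_tonelli_F.
- by move=> w; apply: integral_ge0.
Qed.

(* [normal_prob] lives on [measurableTypeR R], whose display differs from the
   one of the canonical measurable structure of [R]: integrals are transported
   along the identity. *)
Lemma ge0_integral_gaussian_distribution l (f : R -> \bar R) :
  measurable_fun [set: R] f -> (forall x, 0 <= f x)%E ->
  (\int[distribution P (X l)]_x f x = \int[normal_prob 0 1]_x f x)%E.
Proof.
move=> mf f0.
have mid : measurable_fun [set: measurableTypeR R]
    (fun x : measurableTypeR R => x : R).
  by move=> _ B mB; rewrite setTI; exact: mB.
transitivity (\int[pushforward (normal_prob 0 1)
    (fun x : measurableTypeR R => x : R)]_x f x)%E.
  by apply: eq_measure_integral => A mA _; exact: gaussX.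
by rewrite ge0_integral_pushforward.
Qed.

(** [H] and [C] do not involve [X l], so they act as constants in a one-dimensional integral. The
    result has the shape of the input with a new [t], ready for induction over the variables. *)
Lemma integral_gaussian_sqr_step l (H C : T -> R) (t a : R) :
  measurable_fun [set: away l] H -> measurable_fun [set: away l] C ->
  (forall w, 0 <= H w) -> 0 < 1 + 2 * t * a ^+ 2 ->
  (\int[P]_w (H w * expR (- (t * (C w + a * X l w) ^+ 2)))%:E =
   ((Num.sqrt (1 + 2 * t * a ^+ 2))^-1)%:E *
   \int[P]_w (H w * expR (- (t / (1 + 2 * t * a ^+ 2) * C w ^+ 2)))%:E)%E.
Proof.
move=> mH mC H0 D0; set D := 1 + _ in D0 *.
pose F (z : away l * R) : \bar R :=
  (H z.1 * expR (- (t * (C z.1 + a * z.2) ^+ 2)))%:E.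
have mH1 : measurable_fun [set: away l * R] (H \o fst).
  by apply: (measurableT_comp mH); exact: measurable_fst.
have mC1 : measurable_fun [set: away l * R] (C \o fst).
  by apply: (measurableT_comp mC); exact: measurable_fst.
have mF : measurable_fun [set: away l * R] F.
  apply/measurable_EFinP; apply: measurable_funM => //.
  apply: measurable_expRN_sqr; apply: measurable_funD => //.
  by apply: measurable_funM => //; exact: measurable_snd.
have F0 z : (0 <= F z)%E by rewrite lee_fin mulr_ge0// expR_ge0.
rewrite (freeze_independent mF F0) -ge0_integralZl//=.
- apply: eq_integral => w _; rewrite /F.
  under eq_integral do rewrite /= EFinM.
  have mexp : measurable_fun [set: R]
      (fun x => (expR (- (t * (C w + a * x) ^+ 2)))%:E).
    apply/measurable_EFinP; apply: measurable_expRN_sqr.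
    exact: measurable_fun_affine.
  rewrite ge0_integralZl//=; last by rewrite lee_fin.
  rewrite ge0_integral_gaussian_distribution//.
  rewrite integral_normal_prob_expR_sqr// -!EFinM; congr EFin; rewrite -/D; ring.
- apply/measurable_EFinP; apply: measurable_funM; first exact: away_measurable_fun mH.
  by apply: measurable_expRN_sqr; exact: away_measurable_fun mC.
- by move=> w _; rewrite lee_fin mulr_ge0// expR_ge0.
Qed.

End GaussianFreezing.

(** * Exponential moments of sums of squared Gaussian forms *)

Section GaussianBlocks.
Context {d : measure_display} {T : measurableType d} {R : realType}
  (P : probability T R) {I : choiceType} (X : I -> {RV P >-> R}).
Hypothesis indepX : mutually_independent X.
Hypothesis gaussX : forall i, standard_gaussian (X i).

Local Notation away l := (g_sigma_algebraType (cylinders_away X l)).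

Lemma away_measurable_sum l (a : I -> R) (s : seq I) : l \notin s ->
  measurable_fun [set: away l] (fun w => \sum_(i <- s) a i * X i w).
Proof.
elim: s => [_|i s IH].
  by under eq_fun do rewrite big_nil; exact: measurable_cst.
rewrite inE negb_or eq_sym => /andP[il ls].
under eq_fun do rewrite big_cons.
apply: measurable_funD; last exact: IH.
by apply: measurable_funM; [exact: measurable_cst|exact: away_measurable_RV].
Qed.

Lemma integral_gaussian_sqr_block (H : T -> R) (a : I -> R) (s : seq I) (t : R) :
  uniq s -> (forall w, 0 <= H w) ->
  (forall l, l \in s -> measurable_fun [set: away l] H) ->
  0 < 1 + 2 * t * \sum_(i <- s) a i ^+ 2 ->
  (\int[P]_w (H w * expR (- (t * (\sum_(i <- s) a i * X i w) ^+ 2)))%:E =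
   ((Num.sqrt (1 + 2 * t * \sum_(i <- s) a i ^+ 2))^-1)%:E *
   \int[P]_w (H w)%:E)%E.
Proof.
move=> us H0; elim: s us t => [_ t _ _|i s IH /= /andP[iNs us] t mH].
  rewrite big_nil mulr0 addr0 sqrtr1 invr1 mul1e.
  by apply: eq_integral => w _; rewrite big_nil expr0n mulr0 oppr0 expR0 mulr1.
rewrite big_cons; set A := \sum_(j <- s) _ => D0.
have A0 : 0 <= A by apply: sumr_ge0 => j _; exact: sqr_ge0.
have a0 : 0 <= a i ^+ 2 by exact: sqr_ge0.
(* For [t < 0], dropping [A] can only increase the base; for [t >= 0] the base is at least 1. *)
have Di0 : 0 < 1 + 2 * t * a i ^+ 2.
  move: (a i ^+ 2) a0 D0 => x x0 D0; have [t0|t0] := leP 0 t.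
    by rewrite ltr_pwDl// !mulr_ge0.
  by apply: lt_le_trans D0 _; nra.
have Di1 : 1 + 2 * t * a i ^+ 2 != 0 by rewrite gt_eqF.
(* The bases of the successive integrations multiply to the base of the whole block. *)
have DE : (1 + 2 * t * a i ^+ 2) * (1 + 2 * (t / (1 + 2 * t * a i ^+ 2)) * A) =
    1 + 2 * t * (a i ^+ 2 + A) by field.
transitivity (\int[P]_w (H w *
    expR (- (t * (\sum_(j <- s) a j * X j w + a i * X i w) ^+ 2)))%:E)%E.
  by apply: eq_integral => w _; rewrite big_cons [a i * _ + _]addrC.
rewrite (integral_gaussian_sqr_step indepX gaussX)//; first last.
- exact: away_measurable_sum.
- by apply: mH; exact: mem_head.
rewrite IH//; last 2 first.
- by move=> l ls; apply: mH; rewrite inE ls orbT.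
- by rewrite -(pmulr_rgt0 _ Di0) DE.
by rewrite muleA -EFinM -invfM -sqrtrM ?ltW// DE.
Qed.

(** Blocks are peeled off one at a time: their index lists are disjoint, so the exponential of the
    remaining blocks can serve as the factor [H]. *)
Lemma expectation_gaussian_blocks (B : Type) (bs : seq B) (t : B -> R)
    (idx : B -> seq I) (a : I -> R) :
  uniq (flatten [seq idx b | b <- bs]) ->
  (forall b, 0 < 1 + 2 * t b * \sum_(i <- idx b) a i ^+ 2) ->
  (\int[P]_w (expR (- \sum_(b <- bs)
     t b * (\sum_(i <- idx b) a i * X i w) ^+ 2))%:E =
   (\prod_(b <- bs) (Num.sqrt (1 + 2 * t b * \sum_(i <- idx b) a i ^+ 2))^-1)%:E)%E.
Proof.
move=> + D0; elim: bs => [_|b bs IH /=].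
  rewrite big_nil; under eq_integral do rewrite big_nil oppr0 expR0.
  by rewrite integral_cst//= mul1e; exact: probability_setT.
rewrite cat_uniq => /and3P[ub /hasPn bNbs ubs].
transitivity (\int[P]_w (expR (- \sum_(b <- bs)
     t b * (\sum_(i <- idx b) a i * X i w) ^+ 2) *
    expR (- (t b * (\sum_(i <- idx b) a i * X i w) ^+ 2)))%:E)%E.
  by apply: eq_integral => w _; rewrite big_cons opprD expRD mulrC.
rewrite integral_gaussian_sqr_block//; first by rewrite IH// big_cons -EFinM.
move=> l lb; apply: measurableT_comp => //; apply: measurableT_comp => //.
have {}bNbs : l \notin flatten [seq idx b | b <- bs].
  by apply/negP => /bNbs; rewrite lb.
elim: bs bNbs {IH ubs} => [_|c bs IH /=].
  by under eq_fun do rewrite big_nil; exact: measurable_cst.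
rewrite mem_cat negb_or => /andP[lc lbs].
under eq_fun do rewrite big_cons.
apply: measurable_funD; last exact: IH.
by apply: measurable_funM => //; apply: measurable_funX; exact: away_measurable_sum.
Qed.

End GaussianBlocks.

Section GaussianTail.
Context {d : measure_display} {T : measurableType d} {R : realType}
  (P : probability T R) {I : choiceType} (X : I -> {RV P >-> R}).

Definition block_form (B : Type) (bs : seq B) (t : B -> R) (idx : B -> seq I)
    (a : I -> R) (w : T) : R :=
  \sum_(b <- bs) t b * (\sum_(i <- idx b) a i * X i w) ^+ 2.

Lemma measurable_block_form (B : Type) (bs : seq B) (t : B -> R)
    (idx : B -> seq I) (a : I -> R) :
  measurable_fun setT (block_form bs t idx a).
Proof.
apply: measurable_sum => b; apply: measurable_funM => //.
apply: measurable_funX; apply: measurable_sum => i.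
by apply: measurable_funM.
Qed.

Hypothesis indepX : mutually_independent X.
Hypothesis gaussX : forall i, standard_gaussian (X i).

(** Chernoff's bound: the indicator of the event is at most [expR (c - Q w)]. Negative weights [t b]
    turn it into a bound on upper tails of sums of squares. *)
Lemma gaussian_blocks_tail (B : Type) (bs : seq B) (t : B -> R)
    (idx : B -> seq I) (a : I -> R) (c : R) :
  uniq (flatten [seq idx b | b <- bs]) ->
  (forall b, 0 < 1 + 2 * t b * \sum_(i <- idx b) a i ^+ 2) ->
  (P [set w | (block_form bs t idx a w <= c)%R] <= (expR c *
    \prod_(b <- bs) (Num.sqrt (1 + 2 * t b * \sum_(i <- idx b) a i ^+ 2))^-1)%:E)%E.
Proof.
move=> uidx D0; set A := [set w | _]; set Q := block_form bs t idx a.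
have mQ : measurable_fun setT Q by exact: measurable_block_form.
have mA : measurable A.
  by rewrite -[A]setTI; apply: measurable_fun_le.
rewrite EFinM -(expectation_gaussian_blocks indepX gaussX)//.
have mexpQ : measurable_fun setT (fun w => (expR (- Q w))%:E).
  by apply/measurable_EFinP; apply: measurableT_comp => //; exact: measurableT_comp.
rewrite -ge0_integralZl//=.
have -> : P A = (\int[P]_w (\1_A w)%:E)%E by rewrite integral_indic// setIT.
apply: ge0_le_integral => //=.
- exact/measurable_EFinP/measurable_indic.
- by apply: emeasurable_funM.
- move=> w _; rewrite -EFinM lee_fin -expRD indicE.
  have [wA|_] := boolP (w \in A); last exact: expR_ge0.
  by rewrite -[leLHS]expR0 ler_expR subr_ge0; move: wA; rewrite inE.
Qed.

End GaussianTail.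

(** * Integer points of an l1 ball *)

Lemma sum_CauchySchwarz {R : realFieldType} (I : Type) (s : seq I) (a b : I -> R) :
  (\sum_(i <- s) a i * b i) ^+ 2 <=
  (\sum_(i <- s) a i ^+ 2) * (\sum_(i <- s) b i ^+ 2).
Proof.
elim: s => [|i s IH]; first by rewrite !big_nil expr0n mulr0.
rewrite !big_cons; move: IH.
have : 0 <= \sum_(j <- s) a j ^+ 2 by apply: sumr_ge0 => j _; exact: sqr_ge0.
have : 0 <= \sum_(j <- s) b j ^+ 2 by apply: sumr_ge0 => j _; exact: sqr_ge0.
set A := \sum_(j <- s) a j ^+ 2; set B := \sum_(j <- s) b j ^+ 2.
set C := \sum_(j <- s) _; move=> B0 A0 CAB.
have AB : 2 * (a i * b i) * C <= a i ^+ 2 * B + A * b i ^+ 2.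
  have [B_gt0|] := ltP 0 B; last first.
    move=> B_le0; have B_eq0 : B = 0 by apply/eqP; rewrite eq_le B_le0 B0.
    move: CAB; rewrite B_eq0 mulr0 => C2; have -> : C = 0.
      by apply/eqP; rewrite -sqrf_eq0 eq_le C2 sqr_ge0.
    by rewrite !mulr0 add0r mulr_ge0// sqr_ge0.
  rewrite -(ler_pM2r B_gt0).
  have h1 : (C * b i) ^+ 2 <= A * B * b i ^+ 2.
    by rewrite exprMn ler_wpM2r// sqr_ge0.
  have h2 := sqr_ge0 (a i * B - C * b i).
  nra.
by nra.
Qed.

Section LatticeCount.
Context {R : realType} (n M : nat).

(* The integers of absolute value at most [M], shifted by [M]. *)
Local Notation box := 'I_(M + M.+1).
Implicit Type z : {ffun 'I_n -> box}.

Definition box_abs (m : box) : nat := (m - M) + (M - m).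
Definition box_val (m : box) : R := m%:R - M%:R.

Definition l1_le z := (\sum_i box_abs (z i) <= M)%N.

(** The box splits at [M] into the exponents 0, 1, ... and the mirrored exponents 1, 2, ...: two
    truncated geometric series, at most [1 / (1 - q)] and [q / (1 - q)]. *)
Lemma sum_geometric_box (q : R) : 0 <= q < 1 ->
  \sum_(m : box) q ^+ box_abs m <= (1 + q) / (1 - q).
Proof.
move=> /andP[q0 q1]; have q1' : 0 < 1 - q by rewrite subr_gt0.
have geo N : \sum_(i < N) q ^+ i <= (1 - q)^-1.
  rewrite -[leRHS]mul1r ler_pdivlMr// mulrC -[1 - q]opprB mulNr -subrX1 opprB.
  by rewrite gerBl exprn_ge0.
rewrite big_split_ord/= mulrDl mul1r addrC lerD//.
  under eq_bigr => i _ do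
    rewrite /box_abs /= addKn (_ : M - (M + i) = 0)%N ?addn0 ?subnDA ?subnn ?sub0n//.
  exact: geo.
rewrite (reindex_inj rev_ord_inj)/=.
under eq_bigr => i _.
  rewrite /box_abs/= (_ : M - i.+1 - M = 0)%N; last first.
    by apply/eqP; rewrite subn_eq0 leq_subr.
  rewrite add0n subKn// exprS; over.
by rewrite -mulr_sumr; apply: ler_wpM2l => //; exact: geo.
Qed.

(* Each lattice point of the [l1] ball of radius [M] is counted with a weight
   [q ^ |z|_1 >= q ^ M]; the total weight factors over the coordinates. *)
Lemma card_l1_le (q : R) : 0 < q < 1 ->
  (#|[pred z | l1_le z]|)%:R <= q ^- M * ((1 + q) / (1 - q)) ^+ n.
Proof.
move=> /andP[q0 q1]; rewrite ler_pdivlMl ?exprn_gt0//.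
rewrite -sum1_card natr_sum mulr_sumr.
apply: (@le_trans _ _ (\sum_(z : {ffun 'I_n -> box}) \prod_i q ^+ box_abs (z i))).
  rewrite [leRHS](bigID l1_le)/= -[leLHS]addr0 lerD//.
    apply: ler_sum => z lez; rewrite mulr1 -expr_sum.
    by rewrite ler_wiXn2l// ltW.
  by apply: sumr_ge0 => z _; apply: prodr_ge0 => i _; rewrite exprn_ge0 ?ltW.
have -> : \sum_(z : {ffun 'I_n -> box}) \prod_i q ^+ box_abs (z i) =
    (\sum_(m : box) q ^+ box_abs m) ^+ n.
  rewrite -[in RHS](card_ord n) -prodr_const.
  by rewrite (bigA_distr_bigA (fun (_ : 'I_n) (m : box) => q ^+ box_abs m)).
apply: lerXn2r; rewrite ?nnegrE.
- by apply: sumr_ge0 => m _; exact: exprn_ge0 (ltW q0).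
- by rewrite divr_ge0 ?subr_ge0 ?(ltW q1)// addr_ge0// ltW.
- by apply: sum_geometric_box; rewrite q1 andbT ltW.
Qed.

Lemma lattice_point_of (m : 'I_n -> int) : (\sum_i `|m i|%N <= M)%N ->
  exists2 z, l1_le z & forall i, box_val (z i) = (m i)%:~R.
Proof.
move=> mM; have mi i : (`|m i| <= M)%N.
  by apply: leq_trans mM; rewrite (bigD1 i)//= leq_addr.
have mb i : (`|(m i + M%:Z)%R| < M + M.+1)%N by have := mi i; lia.
pose z := [ffun i => Ordinal (mb i) : box].
have zE i : z i = `|(m i + M%:Z)%R|%N :> nat by rewrite ffunE.
exists z; last first.
  move=> i; rewrite /box_val zE.
  have -> : m i = (`|(m i + M%:Z)%R|%N : int) - M%:Z by have := mi i; lia.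
  by rewrite rmorphB/=; congr (_ - _); have := mi i; rewrite subrK.
rewrite /l1_le (leq_trans _ mM)//; apply: leq_sum => i _.
by rewrite /box_abs zE; have := mi i; lia.
Qed.

End LatticeCount.

(** * Rounding to integer points *)

Section Rounding.
Context {R : realType} {n : nat}.
Implicit Types (f : ('I_n -> R) -> R) (c v y : 'I_n -> R).

Definition update v (i : 'I_n) (s : R) : 'I_n -> R :=
  fun j => if j == i then s else v j.

(** For a quadratic form, [c] is the diagonal of its matrix and the sum of the [c i] its trace. The
    cross terms stay hidden in [b], since rounding moves one coordinate at a time. *)
Definition coordinate_quadratic f c :=
  forall v i, exists b, forall s,
    f (update v i s) = f v + b * (s - v i) + c i * (s - v i) ^+ 2.

Lemma coordinate_quadratic_sqr (M : 'I_n -> R) :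
  coordinate_quadratic (fun v => (\sum_i M i * v i) ^+ 2) (fun i => M i ^+ 2).
Proof.
move=> v i; exists (2 * M i * \sum_j M j * v j) => s.
rewrite (bigD1 i)//= {1}/update eqxx (eq_bigr (fun j => M j * v j)); last first.
  by move=> j /negbTE ji; rewrite /update ji.
rewrite [\sum_j M j * v j](bigD1 i)//=; ring.
Qed.

Lemma coordinate_quadratic_sum (J : Type) (r : seq J) (F : J -> ('I_n -> R) -> R)
    (c : J -> 'I_n -> R) : (forall j, coordinate_quadratic (F j) (c j)) ->
  coordinate_quadratic (fun v => \sum_(j <- r) F j v) (fun i => \sum_(j <- r) c j i).
Proof.
move=> qF v i; pose b j := sval (cid (qF j v i)).
have bE j s : F j (update v i s) = F j v + b j * (s - v i) + c j i * (s - v i) ^+ 2.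
  by rewrite /b; case: cid.
exists (\sum_(j <- r) b j) => s; rewrite !mulr_suml -!big_split/=.
by apply: eq_bigr.
Qed.

Lemma coordinate_quadraticZ (k : R) f c : coordinate_quadratic f c ->
  coordinate_quadratic (fun v => k * f v) (fun i => k * c i).
Proof.
by move=> qf v i; have [b bE] := qf v i; exists (k * b) => s; rewrite bE; ring.
Qed.

Lemma coordinate_quadraticB f g c c' : coordinate_quadratic f c ->
  coordinate_quadratic g c' ->
  coordinate_quadratic (fun v => f v - g v) (fun i => c i - c' i).
Proof.
move=> qf qg v i; have [b bE] := qf v i; have [b' bE'] := qg v i.
by exists (b - b') => s; rewrite bE bE'; ring.
Qed.

Lemma coordinate_quadratic_norm2 :
  coordinate_quadratic (fun v => \sum_i v i ^+ 2) (fun=> 1).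
Proof.
move=> v i; exists (2 * v i) => s.
rewrite (bigD1 i)//= {1}/update eqxx (eq_bigr (fun j => v j ^+ 2)); last first.
  by move=> j /negbTE ji; rewrite /update ji.
rewrite [\sum_j v j ^+ 2](bigD1 i)//=; ring.
Qed.

Definition is_rounding (y : R) (m : int) :=
  m = Num.floor y \/ m = Num.floor y + 1.

(* The average of [f] over the two roundings of a coordinate, weighted so that
   the mean is preserved, exceeds [f] by at most [c i / 4]. *)
Lemma round_down_quadratic f c y : coordinate_quadratic f c ->
  exists2 m : 'I_n -> int, forall i, is_rounding (y i) (m i) &
    f (fun i => (m i)%:~R) <= f y + \sum_i Num.max (c i) 0 / 4.
Proof.
move=> qf.
(* Generalizes to a list of coordinates already rounded, the others still being those of [y]. *)
suff [v [vr _ fv]] : exists v, [/\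
    forall i, i \in index_enum 'I_n -> exists2 m, is_rounding (y i) m & v i = m%:~R,
    forall i, i \notin index_enum 'I_n -> v i = y i &
    f v <= f y + \sum_i Num.max (c i) 0 / 4].
  have vr' i : exists2 m, is_rounding (y i) m & v i = m%:~R.
    by apply: vr; rewrite mem_index_enum.
  exists (fun i => s2val (cid2 (vr' i))) => [i|]; first by case: cid2.
  suff <- : v = (fun i => (s2val (cid2 (vr' i)))%:~R) by [].
  by apply/funext => i; case: cid2.
elim: (index_enum _) (index_enum_uniq 'I_n) => [_|i s IH /= /andP[iNs us]].
  by exists y; split=> //; rewrite big_nil addr0.
have [v [vr vy fv]] := IH us; have [b bE] := qf v i.
have viE := vy _ iNs.
have /andP[] := floor_itv (y i); rewrite intrD.
set fl := (Num.floor _)%:~R => fl1 fl2.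
have stepP m : is_rounding (y i) m ->
    f (update v i m%:~R) <= f v + Num.max (c i) 0 / 4 ->
    exists v0, [/\
    forall j, j \in i :: s -> exists2 m, is_rounding (y j) m & v0 j = m%:~R,
    forall j, j \notin i :: s -> v0 j = y j &
    f v0 <= f y + \sum_(j <- i :: s) Num.max (c j) 0 / 4].
  move=> mr fm; exists (update v i m%:~R); split => [j|j|].
  - rewrite inE /update; case: eqP => [-> _|_ /=]; last exact: vr.
    by exists m.
  - by rewrite inE negb_or /update => /andP[/negbTE -> /vy].
  - by rewrite big_cons (le_trans fm)// addrCA [leRHS]addrC lerD2r.
have c4 : c i * ((y i - fl) * (fl + 1 - y i)) <= Num.max (c i) 0 / 4.
  have h1 : c i <= Num.max (c i) 0 by rewrite le_max lexx.
  have h2 : 0 <= Num.max (c i) 0 by rewrite le_max lexx orbT.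
  have h3 : 0 <= (y i - fl) * (fl + 1 - y i) by rewrite mulr_ge0 ?subr_ge0 ?(ltW fl2).
  have h4 : (y i - fl) * (fl + 1 - y i) <= 1 / 4.
    by have := sqr_ge0 (y i - fl - 1 / 2); nra.
  by rewrite (le_trans (ler_wpM2r h3 h1))// ler_wpM2l//; lra.
have [flo|] := leP (f (update v i fl)) (f v + Num.max (c i) 0 / 4).
  by apply: (stepP (Num.floor (y i))) => //; left.
rewrite bE viE => lo.
apply: (stepP (Num.floor (y i) + 1)); first by right.
rewrite intrD -/fl bE viE.
move: c4 lo; set mx := _ / 4; set t := y i - fl => c4 lo.
have t0 : 0 <= t by rewrite subr_ge0.
have t1 : 0 < 1 - t by rewrite /t; lra.
rewrite (_ : fl - y i = - t) in lo; last by rewrite opprB.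
rewrite (_ : fl + 1 - y i = 1 - t) in c4 *; last by rewrite /t; ring.
move: lo; rewrite -!addrA ltrD2l lerD2l => lo; rewrite leNgt; apply/negP => hi.
(* If both roundings exceeded the allowance, their average with weights [1 - t] and [t] would cancel
   the linear term [b] and leave [c i * (t * (1 - t))] above [mx], against [c4]. *)
suff : 0 < c i * (t * (1 - t)) - mx by rewrite ltNge subr_le0 c4.
have h1 : 0 < (1 - t) * (b * - t + c i * (- t) ^+ 2 - mx).
  by rewrite mulr_gt0// subr_gt0.
have h2 : 0 <= t * (b * (1 - t) + c i * (1 - t) ^+ 2 - mx).
  by rewrite mulr_ge0// subr_ge0 ltW.
apply: lt_le_trans (ltr_pwDl h1 h2) _.
rewrite le_eqVlt; apply/orP; left; apply/eqP; ring.
Qed.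

End Rounding.

(** * From integer points to all vectors *)

Section LatticeBounds.
Context {R : realType} {n : nat}.
Implicit Types (f : ('I_n -> R) -> R) (c v y : 'I_n -> R).

(** Rounding [- f] down: its coefficients [- c i] are nonpositive, so the allowance in
    [round_down_quadratic] vanishes. *)
Lemma round_up_quadratic f c y : coordinate_quadratic f c -> (forall i, 0 <= c i) ->
  exists2 m : 'I_n -> int, forall i, is_rounding (y i) (m i) &
    f y <= f (fun i => (m i)%:~R).
Proof.
move=> qf c0.
have [m mr fm] := round_down_quadratic y (coordinate_quadraticZ (-1) qf).
exists m => //; move: fm; rewrite big1 ?addr0 ?mulN1r; first by rewrite ?mulN1r lerN2.
by move=> i _; rewrite mulN1r max_r ?mul0r// oppr_le0.
Qed.

Lemma is_rounding_norm (y : R) (m : int) : is_rounding y m ->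
  `|m%:~R| <= `|y| + 1 :> R.
Proof.
move=> mr; have /andP[] := floor_itv y; rewrite intrD => h1 h2.
have : `|m%:~R - y| <= 1.
  by rewrite ler_norml; case: mr => ->; rewrite ?intrD; apply/andP; split; lra.
move=> h; rewrite -[X in `|X|](subrK y) (le_trans (ler_normD _ _))//.
by rewrite addrC lerD2l.
Qed.

(** Each entry grows by at most 1 in absolute value, and Cauchy-Schwarz bounds the l1 norm of [y] by
    [n * r]. The l1 radius obtained decides which integer points a union bound has to cover. *)
Lemma rounding_norms (r : nat) y (m : 'I_n -> int) :
  \sum_i y i ^+ 2 = n%:R * r%:R ^+ 2 -> (forall i, is_rounding (y i) (m i)) ->
  (\sum_i `|m i|%N <= n * r.+1)%N /\
  \sum_i (m i)%:~R ^+ 2 <= n%:R * r.+1%:R ^+ 2 :> R.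
Proof.
move=> y2 mr.
have y1 : \sum_i `|y i| <= n%:R * r%:R.
  have := sum_CauchySchwarz (index_enum 'I_n) (fun i => `|y i|) (fun=> 1).
  under eq_bigr do rewrite mulr1.
  under [in X in _ <= X * _]eq_bigr do rewrite -normrX ger0_norm ?sqr_ge0//.
  under [in X in _ <= _ * X]eq_bigr do rewrite expr1n.
  rewrite y2 sumr_const card_ord mulrAC -expr2 -exprMn ler_sqr// nnegrE.
    by apply: sumr_ge0 => i _.
  by rewrite mulr_ge0.
have m1 i : `|(m i)%:~R| <= `|y i| + 1 :> R by exact: is_rounding_norm.
split.
  rewrite -(ler_nat R) natr_sum natrM -[r.+1]addn1 natrD mulrDr mulr1.
  apply: (@le_trans _ _ (\sum_i (`|y i| + 1))).
    by apply: ler_sum => i _; rewrite natr_absz intr_norm.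
  by rewrite big_split/= sumr_const card_ord lerD2r.
apply: (@le_trans _ _ (\sum_i (y i ^+ 2 + 2 * `|y i| + 1))).
  apply: ler_sum => i _; rewrite -[leLHS]ger0_norm ?sqr_ge0// normrX.
  have -> : y i ^+ 2 + 2 * `|y i| + 1 = (`|y i| + 1) ^+ 2.
    by rewrite sqrrD -[in RHS]normrX (ger0_norm (sqr_ge0 _)) mulr1 expr1n mulr_natl.
  by rewrite ler_sqr ?nnegrE ?addr_ge0.
rewrite !big_split/= y2 sumr_const card_ord -mulr_sumr -[r.+1]addn1 natrD.
have -> : n%:R * (r%:R + 1%:R) ^+ 2 = n%:R * r%:R ^+ 2 + 2 * (n%:R * r%:R) + n%:R :> R.
  by ring.
by rewrite lerD2r lerD2l ler_wpM2l.
Qed.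

Definition homogeneous2 f := forall s v, f (fun i => s * v i) = s ^+ 2 * f v.

Lemma homogeneous2_sphere f (r : nat) :
  (0 < n)%N -> (0 < r)%N -> homogeneous2 f ->
  (forall y, \sum_i y i ^+ 2 = n%:R * r%:R ^+ 2 -> 0 <= f y) ->
  forall v, 0 <= f v.
Proof.
move=> n0 r0 hf fy v; pose N := \sum_i v i ^+ 2.
have N0 : 0 <= N by apply: sumr_ge0 => i _; exact: sqr_ge0.
move: N0; rewrite le_eqVlt => /orP[/eqP N0|N0].
  have -> : v = (fun i => 0 * v i).
    apply/funext => i; rewrite mul0r; apply/eqP; rewrite -sqrf_eq0.
    by rewrite (psumr_eq0P _ (esym N0))// => j _; exact: sqr_ge0.
  by rewrite hf expr0n mul0r.
have rn0 : 0 < n%:R * r%:R ^+ 2 :> R by rewrite mulr_gt0 ?exprn_gt0 ?ltr0n.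
pose s := Num.sqrt (n%:R * r%:R ^+ 2 / N).
have s2 : s ^+ 2 = n%:R * r%:R ^+ 2 / N by rewrite sqr_sqrtr// divr_ge0 ?ltW.
rewrite -(@pmulr_rge0 _ (s ^+ 2)) ?s2 ?divr_gt0// -s2 -hf; apply: fy.
under eq_bigr do rewrite exprMn.
by rewrite -mulr_sumr s2 -/N divfK// gt_eqF.
Qed.

(** On the sphere of radius [r * sqrt n], a suitable rounding does not decrease [f] and has squared
    norm at most [((r + 1) / r) ^ 2] times larger; homogeneity covers the other vectors. *)
Lemma lattice_upper_bound (r : nat) f c (K : R) :
  (0 < n)%N -> (0 < r)%N -> 0 <= K ->
  coordinate_quadratic f c -> (forall i, 0 <= c i) -> homogeneous2 f ->
  (forall z : {ffun 'I_n -> 'I_(n * r.+1 + (n * r.+1).+1)}, l1_le z ->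
     f (fun i => box_val (z i)) <= K * \sum_i box_val (z i) ^+ 2) ->
  forall v, f v <= K * (r.+1%:R / r%:R) ^+ 2 * \sum_i v i ^+ 2.
Proof.
move=> n0 r0 K0 qf c0 hf fz v.
pose g v := K * (r.+1%:R / r%:R) ^+ 2 * (\sum_i v i ^+ 2) - f v.
suff : 0 <= g v by rewrite subr_ge0.
apply: (homogeneous2_sphere n0 r0) => [s w|y y2].
  rewrite /g hf; under eq_bigr do rewrite exprMn.
  by rewrite -mulr_sumr; ring.
have [m mr fm] := round_up_quadratic y qf c0.
have [m1 m2] := rounding_norms y2 mr.
have [z lz zE] := @lattice_point_of R _ _ _ m1.
have rr0 : r%:R != 0 :> R by rewrite pnatr_eq0 -lt0n.
rewrite /g y2 subr_ge0 (le_trans fm)//.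
have -> : (fun i => (m i)%:~R) = (fun i => box_val (z i)) :> ('I_n -> R).
  by apply/funext => i; rewrite zE.
rewrite (le_trans (fz _ lz))//; under eq_bigr do rewrite zE.
rewrite -mulrA ler_wpM2l// (le_trans m2)// le_eqVlt; apply/orP; left; apply/eqP.
by field.
Qed.

(** The form that is rounded is [f] minus [K] times the squared norm, nonnegative at the integer
    points. Rounding adds at most a quarter of the sum of the [c i]; divided by the squared norm
    [n * r ^ 2] of the sphere, this is the loss in the constant. *)
Lemma lattice_lower_bound (r : nat) f c (K : R) :
  (0 < n)%N -> (0 < r)%N -> 0 <= K ->
  coordinate_quadratic f c -> (forall i, 0 <= c i) -> homogeneous2 f ->
  (forall z : {ffun 'I_n -> 'I_(n * r.+1 + (n * r.+1).+1)}, l1_le z ->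
     K * \sum_i box_val (z i) ^+ 2 <= f (fun i => box_val (z i))) ->
  forall v, (K - (\sum_i c i) / (4 * n%:R * r%:R ^+ 2)) * \sum_i v i ^+ 2 <= f v.
Proof.
move=> n0 r0 K0 qf c0 hf fz v; set k := K - _.
pose g v := f v - k * (\sum_i v i ^+ 2).
suff : 0 <= g v by rewrite subr_ge0.
apply: (homogeneous2_sphere n0 r0) => [s w|y y2].
  rewrite /g hf; under eq_bigr do rewrite exprMn.
  by rewrite -mulr_sumr; ring.
have qN := coordinate_quadraticZ K (@coordinate_quadratic_norm2 R n).
have [m mr] := round_down_quadratic y (coordinate_quadraticB qf qN).
have [m1 m2] := rounding_norms y2 mr.
have [z lz zE] := @lattice_point_of R _ _ _ m1.
have -> : (fun i => (m i)%:~R) = (fun i => box_val (z i)) :> ('I_n -> R).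
  by apply/funext => i; rewrite zE.
have rr0 : r%:R != 0 :> R by rewrite pnatr_eq0 -lt0n.
have nn0 : n%:R != 0 :> R by rewrite pnatr_eq0 -lt0n.
rewrite (eq_bigr (fun i => box_val (z i) ^+ 2)) => [fm|i _]; last by rewrite zE.
have := fz _ lz; rewrite -subr_ge0 => fz0.
have cmax : \sum_i Num.max (c i - K * 1) 0 / 4 <= (\sum_i c i) / 4.
  rewrite mulr_suml; apply: ler_sum => i _; rewrite ler_pM2r// ge_max c0 andbT.
  by rewrite mulr1 gerBl.
rewrite /g y2 /k.
have -> : f y - (K - (\sum_i c i) / (4 * n%:R * r%:R ^+ 2)) * (n%:R * r%:R ^+ 2) =
   f y - K * (n%:R * r%:R ^+ 2) + (\sum_i c i) / 4 by field; rewrite rr0.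
rewrite (le_trans fz0)// (le_trans fm)// y2 lerD2l.
exact: cmax.
Qed.

End LatticeBounds.

(** * Tail bounds for Gaussian matrices *)

Section ExpBounds.
Context {R : realType}.
Implicit Type x y : R.

Lemma expR_ge_exprn (m : nat) x : (0 < m)%N -> 0 <= 1 + x / m%:R ->
  (1 + x / m%:R) ^+ m <= expR x.
Proof.
move=> m0 x0; have -> : expR x = expR (x / m%:R) ^+ m.
  by rewrite -expRM_natr divfK// pnatr_eq0 -lt0n.
by rewrite lerXn2r ?nnegrE ?expR_ge0// expR_ge1Dx.
Qed.

Lemma expR_le_exprn (m : nat) x : (0 < m)%N -> 0 < 1 - x / m%:R ->
  expR x <= (1 - x / m%:R) ^- m.
Proof.
move=> m0 x0; rewrite -[x in expR x]opprK expRN lef_pV2 ?posrE ?expR_gt0 ?exprn_gt0//.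
  by have := @expR_ge_exprn m (- x) m0; rewrite mulNr; apply; exact: ltW.
Qed.

(** Follows from [1 <= (1 - y) * (1 + 2 * y)], valid up to [y = 1 / 2], and
    [1 + 2 * y <= expR (2 * y)]. *)
Lemma inv_sqrt1B_le_expR y : 0 <= y <= 1 / 2 -> (Num.sqrt (1 - y))^-1 <= expR y.
Proof.
move=> /andP[y0 y1]; have y2 : 0 < 1 - y by lra.
rewrite -[leRHS]invrK -expRN lef_pV2 ?posrE ?sqrtr_gt0 ?expR_gt0//.
rewrite -[leLHS]ger0_norm ?expR_ge0// -sqrtr_sqr ler_sqrt ?(ltW y2)//.
rewrite -expRM_natr.
have y3 : 0 < 1 + y * 2 by lra.
rewrite mulNr expRN invf_ple ?posrE ?expR_gt0//.
apply: le_trans (expR_ge1Dx _).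
rewrite -(ler_pM2r y2) mulVf ?gt_eqF//; nra.
Qed.

End ExpBounds.

Section UnionBound.
Context {d : measure_display} {T : measurableType d} {R : realType}
  (P : probability T R).

Lemma bigsetU_in (J : finType) (p : pred J) (F : J -> set T) j w :
  p j -> F j w -> (\big[setU/set0]_(i | p i) F i) w.
Proof. by move=> pj Fjw; rewrite (bigD1 j)//=; left. Qed.

Lemma probability_bigsetU_le (J : finType) (p : pred J) (F : J -> set T) (e C : R) :
  0 <= e -> (#|p|)%:R <= C ->
  (forall j, p j -> measurable (F j)) -> (forall j, p j -> P (F j) <= e%:E)%E ->
  (P (\big[setU/set0]_(j | p j) F j) <= (C * e)%:E)%E.
Proof.
move=> e0 pC mF Fe.
apply: (@le_trans _ _ (\sum_(j | p j) e%:E)%E); last first.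
  rewrite sumEFin lee_fin sumr_const -mulr_natl ler_wpM2r//.
pose K (A : set T) (x : \bar R) := measurable A /\ (P A <= x)%E.
suff [] : K (\big[setU/set0]_(j | p j) F j) (\sum_(j | p j) e%:E)%E by [].
apply: (big_ind2 K); first by split=> //; rewrite measure0.
- move=> A x B y [mA Ax] [mB By]; split; first exact: measurableU.
  by rewrite (le_trans (measureU2 _ mA mB))// leeD.
- by move=> j pj; split; [exact: mF|exact: Fe].
Qed.

End UnionBound.

Section GaussianMatrixTails.
Context {d : measure_display} {T : measurableType d} {R : realType}
  (P : probability T R) {n : nat} (g : 'I_n -> nat -> {RV P >-> R}).
Hypothesis gg : gaussian_matrix g.

Local Notation X := (fun ij : 'I_n * nat => g ij.1 ij.2).

Let gaussX ij : standard_gaussian (X ij).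
Proof. by case: gg => _; exact. Qed.

Let indepX : mutually_independent X. Proof. by case: gg. Qed.

Lemma uniq_flatten_pairs (I J A B : eqType) (f : A -> B -> I * J) (s : seq A)
    (t : seq B) : injective (fun ab => f ab.1 ab.2) -> uniq s -> uniq t ->
  uniq (flatten [seq [seq f a b | b <- t] | a <- s]).
Proof.
move=> f_inj us ut; apply: allpairs_uniq => // -[x1 x2] [y1 y2] _ _ /=.
exact: (f_inj (x1, x2) (y1, y2)).
Qed.

(** Rows are the blocks; the weight [th / N] makes the base of every row [1 + 2 * th], whatever [z]
    is. *)
Lemma head_tail_bound (k : nat) (z : 'I_k -> R) (u th : R) :
  0 < th -> 0 < \sum_j z j ^+ 2 ->
  (P [set w | (\sum_i (\sum_(j < k) g i j w * z j) ^+ 2 <=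
               u * \sum_j z j ^+ 2)%R] <=
   (expR (th * u) * (Num.sqrt (1 + 2 * th))^-1 ^+ n)%:E)%E.
Proof.
move=> th0; set N := \sum_j _ => N0.
pose idx (i : 'I_n) := [seq (i, val j) | j <- enum 'I_k].
pose a (ij : 'I_n * nat) := oapp z 0 (insub ij.2).
have aE i (j : 'I_k) : a (i, val j) = z j by rewrite /a/= valK.
have sumE i : \sum_(ij <- idx i) a ij ^+ 2 = N.
  by rewrite big_map big_enum/=; apply: eq_bigr => j _; rewrite aE.
have tN : 2 * (th / N) * N = 2 * th by rewrite -mulrA divfK// gt_eqF.
have formE w : block_form X (enum 'I_n) (fun=> th / N) idx a w =
    th / N * \sum_i (\sum_(j < k) g i j w * z j) ^+ 2.
  rewrite /block_form big_enum/= -mulr_sumr; congr (_ * _); apply: eq_bigr => i _.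
  rewrite big_map big_enum/=; congr (_ ^+ 2); apply: eq_bigr => j _.
  by rewrite aE mulrC.
rewrite (_ : [set w | _] =
    [set w | block_form X (enum 'I_n) (fun=> th / N) idx a w <= th * u]); last first.
  apply/seteqP; split => w /=;
    by rewrite formE -mulrA ler_pM2l// ler_pdivrMl// [N * u]mulrC.
apply: le_trans (gaussian_blocks_tail indepX gaussX _ _ _) _.
- apply: uniq_flatten_pairs; rewrite ?enum_uniq//.
  by move=> [i j] [i' j'] [-> /val_inj ->].
- by move=> i; rewrite sumE tN; lra.
rewrite lee_fin big_enum/= (eq_bigr (fun=> (Num.sqrt (1 + 2 * th))^-1)).
  by rewrite prodr_const card_ord.
by move=> i _; rewrite sumE tN.
Qed.

(** Each entry is a block of its own; the weight [- (1 / 10)] gives the base [4 / 5]. *)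
Lemma frobenius_tail_bound (k : nat) (c : R) :
  (P [set w | (c <= \sum_i \sum_(j < k) g i j w ^+ 2)%R] <=
   (expR (- (c / 10)) * (Num.sqrt (4 / 5))^-1 ^+ (n * k))%:E)%E.
Proof.
pose bs := [seq (i, val j) | i <- enum 'I_n, j <- enum 'I_k].
pose t (_ : 'I_n * nat) : R := - (1 / 10).
pose idx (ij : 'I_n * nat) := [:: ij].
have formE w : block_form X bs t idx (fun=> 1) w =
    - (1 / 10) * \sum_i \sum_(j < k) g i j w ^+ 2.
  rewrite /block_form /bs big_allpairs_dep big_enum/= mulr_sumr; apply: eq_bigr => i _.
  rewrite big_enum/= mulr_sumr; apply: eq_bigr => j _.
  by rewrite big_seq1 mul1r.
rewrite (_ : [set w | _] =
    [set w | block_form X bs t idx (fun=> 1) w <= - (c / 10)]); last first.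
  by apply/seteqP; split => w /=; rewrite formE => h; lra.
have tE : 1 + 2 * - (1 / 10) * 1 ^+ 2 = 4 / 5 :> R by field.
apply: le_trans (gaussian_blocks_tail indepX gaussX _ _ _) _.
- have -> : flatten [seq idx b | b <- bs] = bs by elim: (bs) => //= b s ->.
  apply: (@uniq_flatten_pairs _ _ _ _ (fun i (j : 'I_k) => (i, val j)));
    rewrite ?enum_uniq//.
  by move=> [i j] [i' j'] [-> /val_inj ->].
- by move=> ij; rewrite big_seq1 tE.
rewrite lee_fin ler_wpM2l ?expR_ge0// le_eqVlt; apply/orP; left; apply/eqP.
rewrite (eq_bigr (fun=> (Num.sqrt (4 / 5))^-1)); last first.
  by move=> ij _; rewrite big_seq1 tE.
rewrite big_const_seq count_predT size_allpairs !size_enum_ord.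
by rewrite iter_mulr_1.
Qed.

(** Columns are the blocks, with negative weights because this is an upper tail. The bound is
    uniform in [N], so that [N] can go to infinity later. *)
Lemma series_tail_bound (s : nat -> R) (N : nat) (z : 'I_n -> R) (S : R) :
  0 < S -> (forall b, s b ^+ 2 <= 4 * S / n%:R) -> \sum_(b < N) s b ^+ 2 <= S ->
  0 < \sum_i z i ^+ 2 -> forall k,
  (P [set w | (64 * S * \sum_i z i ^+ 2 <=
     \sum_(b < N) s b ^+ 2 * (\sum_i g i (k + b)%N w * z i) ^+ 2)%R] <=
   (expR (- (31 / 8 * n%:R)))%:E)%E.
Proof.
move=> S0 s4 sS z0 k; set Z := \sum_i _ in z0 *.
have [n0|n0] := posnP n.
  by move: z0; rewrite /Z big1 ?ltxx// => i _; have := leq_trans (ltn_ord i) (eq_leq n0).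
have nR0 : 0 < n%:R :> R by rewrite ltr0n.
(* This [l] makes the base of block [b] equal to [1 - y b] with [y b <= 1 / 2], and turns the
   threshold [64 * S * Z] into the exponent [4 * n]. *)
pose l := n%:R / (16 * S * Z).
have l0 : 0 < l by rewrite divr_gt0 ?mulr_gt0.
pose bs := index_iota 0 N.
pose t b := - (l * s b ^+ 2).
pose idx b := [seq (i, k + b)%N | i <- enum 'I_n].
pose a (ij : 'I_n * nat) := z ij.1.
pose y b := n%:R * s b ^+ 2 / (8 * S).
have formE w : block_form X bs t idx a w =
    - (l * \sum_(b < N) s b ^+ 2 * (\sum_i g i (k + b)%N w * z i) ^+ 2).
  rewrite /block_form big_mkord mulr_sumr -sumrN; apply: eq_bigr => b _.
  rewrite big_map big_enum/= /t mulNr -mulrA; congr (- (_ * (_ * _ ^+ 2))).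
  by apply: eq_bigr => i _; rewrite mulrC.
rewrite (_ : [set w | _] =
    [set w | block_form X bs t idx a w <= - (4 * n%:R)]); last first.
  have lE : l * (64 * S * Z) = 4 * n%:R by rewrite /l; field; rewrite !gt_eqF.
  by apply/seteqP; split => w /=; rewrite formE lerN2 -lE ler_pM2l.
have yE b : 1 + 2 * t b * \sum_(ij <- idx b) a ij ^+ 2 = 1 - y b.
  rewrite big_map big_enum/= -/Z /t /y /l; field.
  by rewrite !gt_eqF.
have y01 b : 0 <= y b <= 1 / 2.
  have S8 : 0 < 8 * S by rewrite mulr_gt0.
  have := s4 b; rewrite ler_pdivlMr// => h.
  apply/andP; split; rewrite /y; last by rewrite ler_pdivrMr//; lra.
  by apply: divr_ge0; [apply: mulr_ge0 => //; exact: sqr_ge0|exact: ltW].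
apply: le_trans (gaussian_blocks_tail indepX gaussX _ _ _) _.
- apply: (@uniq_flatten_pairs _ _ _ _ (fun b (i : 'I_n) => (i, k + b)%N));
    rewrite ?enum_uniq ?iota_uniq//.
  by move=> [b i] [b' i'] [-> /addnI ->].
- by move=> b; rewrite yE; have := y01 b; lra.
rewrite lee_fin.
(* The blocks cost at most the exponential of the sum of the [y b], which is at most [n / 8]. *)
have -> : - (31 / 8 * n%:R) = - (4 * n%:R) + n%:R / 8 :> R by field.
rewrite expRD ler_wpM2l ?expR_ge0//.
apply: (@le_trans _ _ (\prod_(b <- bs) expR (y b))).
  apply: ler_prod => b _; rewrite invr_ge0 sqrtr_ge0 yE/=.
  exact: inv_sqrt1B_le_expR.
rewrite -expR_sum ler_expR /bs big_mkord /y.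
under eq_bigr do rewrite mulrAC.
rewrite -mulr_sumr; apply: le_trans (ler_wpM2l _ sS) _.
  by rewrite divr_ge0 ?mulr_ge0 ?ltW.
by rewrite le_eqVlt; apply/orP; left; apply/eqP; field; rewrite gt_eqF.
Qed.

End GaussianMatrixTails.

(** * Union bounds for the three exceptional events *)

Section GaussianMatrixEvents.
Context {d : measure_display} {T : measurableType d} {R : realType}
  (P : probability T R) {n : nat} (g : 'I_n -> nat -> {RV P >-> R}).
Hypothesis gg : gaussian_matrix g.
Hypothesis n50 : (50 <= n)%N.

Local Notation k := (n %/ 2)%N.

(* [(12 / 11) ^+ 12 * 23] is the factor per coordinate in [card_l1_le] for radius
   [12 k] and [q = 11 / 12]; [expR (199 / 200) / 200] is the square of the
   factor per row in [head_tail_bound] at [u = n / 200] and [th = 199 / 2], the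
   value that minimizes [expR (th / 200) / sqrt (1 + 2 th)]. *)
Lemma head_constant :
  (12 / 11) ^+ 12 * 23 * (expR (199 / 200) / 200) <= expR (- (1 / 20)) :> R.
Proof.
have -> : expR (- (1 / 20)) = expR (199 / 200) * expR (- (209 / 200)) :> R.
  by rewrite -expRD; congr expR; field.
rewrite mulrCA ler_pM2l ?expR_gt0// expRN.
rewrite ler_pdivrMr// [leRHS]mulrC ler_pdivlMr ?expR_gt0//.
apply: (@le_trans _ _ ((12 / 11) ^+ 12 * 23 * (1 - 209 / 200 / 16%:R) ^- 16)).
  by apply: ler_wpM2l; [lra|apply: expR_le_exprn => //; lra].
rewrite -exprVn (_ : (1 - _)^-1 = 3200 / 2991); last by field.
lra.
Qed.

(** The l1 radius [12 * k] is the one required by rounding on the sphere of radius [11 * sqrt k].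
    Only nonzero points enter the union; at zero the inequality is trivial. *)
Lemma head_event : exists B : set T,
  [/\ measurable B, (P B <= (expR (- (n%:R / 50)))%:E)%E &
   forall w, ~ B w ->
   forall z : {ffun 'I_k -> 'I_(k * 12 + (k * 12).+1)}, l1_le z ->
   n%:R / 200 * (\sum_j box_val (z j) ^+ 2) <=
   \sum_i (\sum_(j < k) g i j w * box_val (z j)) ^+ 2].
Proof.
pose N (z : {ffun 'I_k -> 'I_(k * 12 + (k * 12).+1)}) : R :=
  \sum_j box_val (z j) ^+ 2.
pose F (z : {ffun 'I_k -> 'I_(k * 12 + (k * 12).+1)}) :=
  [set w | (\sum_i (\sum_(j < k) g i j w * box_val (z j)) ^+ 2 <=
                      n%:R / 200 * N z)%R].
pose p := [pred z | l1_le z && (0 < N z)].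
exists (\big[setU/set0]_(z | p z) F z); split.
- apply: bigsetU_measurable => z _; rewrite -[F z]setTI.
  apply: measurable_fun_le => //; apply: measurable_sum => i.
  by apply: measurable_funX; apply: measurable_sum => j; exact: measurable_funM.
- pose e : R := expR (199 / 2 * (n%:R / 200)) * (Num.sqrt (1 + 2 * (199 / 2)))^-1 ^+ n.
  pose C : R := (11 / 12) ^- (k * 12) * ((1 + 11 / 12) / (1 - 11 / 12)) ^+ k.
  have e0 : 0 <= e.
    apply: mulr_ge0; first exact: expR_ge0.
    by apply: exprn_ge0; rewrite invr_ge0 sqrtr_ge0.
  apply: (@le_trans _ _ (C * e)%:E).
    apply: probability_bigsetU_le => //.
    + have h : 0 < (11 / 12 : R) < 1 by apply/andP; split; lra.
      apply: le_trans (card_l1_le _ _ h); rewrite ler_nat; apply: subset_leq_card.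
      by apply/fintype.subsetP => z; rewrite !inE => /andP[].
    + move=> z _; rewrite -[F z]setTI.
      apply: measurable_fun_le => //; apply: measurable_sum => i.
      by apply: measurable_funX; apply: measurable_sum => j; exact: measurable_funM.
    + move=> z /andP[_ Nz]; rewrite /F.
      by apply: (head_tail_bound gg) => //; lra.
  rewrite lee_fin; pose x : R := expR (199 / 400) / Num.sqrt 200.
  have x0 : 0 <= x by rewrite divr_ge0 ?expR_ge0 ?sqrtr_ge0.
  have x2 : x ^+ 2 = expR (199 / 200) / 200.
    rewrite exprMn exprVn sqr_sqrtr// -expRM_natr.
    by congr (expR _ / _); field.
  have eE : e = x ^+ n.
    rewrite /e /x exprMn -expRM_natr.
    by congr (expR _ * (Num.sqrt _)^-1 ^+ _); field.
  have hc := head_constant; rewrite -x2 in hc.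
  have x1 : x <= 1.
    rewrite -(@expr_le1 _ 2)//.
    apply: le_trans (_ : expR (- (1 / 20)) <= 1); last first.
      by rewrite -[leRHS]expR0 ler_expR; lra.
    by apply: le_trans hc; apply: ler_peMl; [exact: sqr_ge0|lra].
  (* As [2 * k <= n] and [x <= 1], two rows can be set against each coordinate counted in [C]. *)
  have en : e <= (x ^+ 2) ^+ k.
    rewrite eE -exprM ler_wiXn2l// mulnC; exact: leq_trunc_div.
  have CE : C = ((12 / 11) ^+ 12 * 23) ^+ k.
    rewrite /C -exprVn mulnC exprM -exprMn; congr (_ ^+ _).
    rewrite (_ : (11 / 12)^-1 = 12 / 11); last by field.
    by congr (_ * _); field.
  have C0 : 0 <= C by rewrite CE; apply: exprn_ge0; lra.
  apply: (le_trans (ler_wpM2l C0 en)).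
  rewrite CE -exprMn; apply: (@le_trans _ _ (expR (- (1 / 20)) ^+ k)).
    apply: lerXn2r; rewrite ?nnegrE ?expR_ge0//.
    by apply: mulr_ge0; [lra|exact: sqr_ge0].
  rewrite -expRM_natr ler_expR.
  (* Equivalent to [n / 50 <= k / 20]. *)
  have kn : (2 * n <= 5 * k)%N by lia.
  by move: kn; rewrite -(ler_nat R) !natrM => kn; lra.
- move=> w wB z lz; rewrite leNgt; apply/negP => wz; apply: wB.
  have [Nz|Nz] := ltP 0 (N z).
    by apply: (bigsetU_in (p := p) (j := z)); [rewrite /= lz|exact: ltW].
  exfalso; move: wz; apply/negP; rewrite -leNgt.
  apply: (@le_trans _ _ 0); first by apply: mulr_ge0_le0 => //; exact: divr_ge0.
  by apply: sumr_ge0 => i _; exact: sqr_ge0.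
Qed.

Lemma frobenius_event : exists B : set T,
  [/\ measurable B, (P B <= (expR (- (n%:R / 50)))%:E)%E &
   forall w, ~ B w ->
   \sum_i \sum_(j < k) g i j w ^+ 2 <= 5 / 4 * n%:R * k%:R].
Proof.
exists [set w | (5 / 4 * n%:R * k%:R <= \sum_i \sum_(j < k) g i j w ^+ 2)%R]; split.
- rewrite -[X in measurable X]setTI; apply: measurable_fun_le => //.
  apply: measurable_sum => i; apply: measurable_sum => j; exact: measurable_funX.
- apply: le_trans (frobenius_tail_bound gg _ _) _; rewrite lee_fin.
  (* The exponent per entry becomes [- 1 / 8 + 23 / 200 = - 1 / 100], and [k >= 2] turns
     [n * k / 100] into at least [n / 50]. *)
  have h : (Num.sqrt (4 / 5))^-1 <= expR (23 / 200) :> R.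
    rewrite -[leRHS]invrK lef_pV2 ?posrE ?invr_gt0 ?expR_gt0 ?sqrtr_gt0//.
    rewrite -expRN -[leLHS]ger0_norm ?expR_ge0// -sqrtr_sqr ler_sqrt//.
    rewrite -expRM_natr (_ : - (23 / 200) * 2%:R = - (23 / 100)); last by field.
    rewrite expRN invf_ple ?posrE ?expR_gt0//.
    have h4 : (1 + 23 / 100 / 4%:R) ^+ 4 <= expR (23 / 100) :> R.
      by apply: expR_ge_exprn; [|lra].
    by apply: le_trans h4; lra.
  apply: (@le_trans _ _ (expR (- (5 / 4 * n%:R * k%:R / 10)) *
                         expR (23 / 200) ^+ (n * k))).
    apply: ler_wpM2l; first exact: expR_ge0.
    by apply: lerXn2r; rewrite ?nnegrE ?expR_ge0 ?invr_ge0 ?sqrtr_ge0.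
  rewrite -expRM_natr -expRD ler_expR natrM.
  have k2 : 2 <= k%:R :> R by rewrite ler_nat; lia.
  have n0 : 0 <= n%:R :> R by [].
  nra.
- by move=> w /= /negP; rewrite -ltNge => /ltW.
Qed.

Lemma series_event (s : nat -> R) (S : R) : 0 <= S ->
  (forall b, s b ^+ 2 <= 4 * S / n%:R) ->
  (forall N, \sum_(b < N) s b ^+ 2 <= S) ->
  exists B : set T,
  [/\ measurable B, (P B <= (expR (- (n%:R / 50)))%:E)%E &
   forall w, ~ B w -> forall N,
   forall z : {ffun 'I_n -> 'I_(n * 5 + (n * 5).+1)}, l1_le z ->
   \sum_(b < N) s b ^+ 2 * (\sum_i g i (k + b)%N w * box_val (z i)) ^+ 2 <=
   64 * S * \sum_i box_val (z i) ^+ 2].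
Proof.
rewrite le_eqVlt => /orP[/eqP <- _ sS|S0 s4 sS].
  (* If [S = 0], every [s b] vanishes and nothing has to be excluded. *)
  exists set0; split => [//||w _ N z lz]; first by rewrite measure0 lee_fin expR_ge0.
  rewrite mulr0 mul0r big1// => b _; have := sS b.+1.
  rewrite big_ord_recr/= => sb; have -> : s b ^+ 2 = 0; last by rewrite mul0r.
  apply/eqP; rewrite eq_le sqr_ge0 andbT; apply: le_trans sb.
  by rewrite lerDr sumr_ge0// => i _; exact: sqr_ge0.
pose Z (z : {ffun 'I_n -> 'I_(n * 5 + (n * 5).+1)}) : R :=
  \sum_i box_val (z i) ^+ 2.
pose Q N (z : {ffun 'I_n -> 'I_(n * 5 + (n * 5).+1)}) w : R :=
  \sum_(b < N) s b ^+ 2 * (\sum_i g i (k + b)%N w * box_val (z i)) ^+ 2.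
pose F (z : {ffun 'I_n -> 'I_(n * 5 + (n * 5).+1)}) N :=
  [set w | (64 * S * Z z <= Q N z w)%R].
have mF z N : measurable (F z N).
  rewrite -[F z N]setTI; apply: measurable_fun_le => //; apply: measurable_sum => b.
  apply: measurable_funM => //; apply: measurable_funX; apply: measurable_sum => i.
  exact: measurable_funM.
have mUF z : measurable (\bigcup_N F z N) by exact: bigcupT_measurable.
pose p := [pred z | l1_le z && (0 < Z z)].
have FU z : p z -> (P (\bigcup_N F z N) <= (expR (- (31 / 8 * n%:R)))%:E)%E.
  move=> /andP[_ z0].
  (* The events grow with [N], so the uniform bound passes to their union by continuity from
     below. *)
  have cvgF : (P \o F z) N @[N --> \oo] --> P (\bigcup_N F z N).
    apply: nondecreasing_cvg_mu => // N N' NN'; apply/subsetPset => w /=.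
    rewrite /F/= => h; apply: le_trans h _; rewrite /Q.
    rewrite -(subnKC NN') big_split_ord/= lerDl sumr_ge0// => b _.
    by rewrite mulr_ge0// sqr_ge0.
  rewrite -(cvg_lim _ cvgF)//; apply: lime_le.
    by apply/cvg_ex; eexists; exact: cvgF.
  by apply: nearW => N; exact: (series_tail_bound gg).
exists (\big[setU/set0]_(z | p z) \bigcup_N F z N); split.
- by apply: bigsetU_measurable.
- pose C : R := (4 / 5) ^- (n * 5) * ((1 + 4 / 5) / (1 - 4 / 5)) ^+ n.
  apply: (@le_trans _ _ (C * expR (- (31 / 8 * n%:R)))%:E).
    apply: probability_bigsetU_le => //.
    have h : 0 < (4 / 5 : R) < 1 by apply/andP; split; lra.
    apply: le_trans (card_l1_le _ _ h); rewrite ler_nat; apply: subset_leq_card.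
    by apply/fintype.subsetP => z; rewrite !inE => /andP[].
  rewrite lee_fin.
  (* [31 / 8 - 1 / 50 = 771 / 200] is the exponent left to absorb the count, a factor
     [(5 / 4) ^+ 5 * 9] per coordinate. *)
  have -> : expR (- (n%:R / 50)) =
      expR (771 / 200 * n%:R) * expR (- (31 / 8 * n%:R)) :> R.
    by rewrite -expRD; congr expR; field.
  rewrite ler_wpM2r ?expR_ge0// expRM_natr.
  have -> : C = ((5 / 4) ^+ 5 * 9) ^+ n.
    rewrite /C -exprVn mulnC exprM -exprMn; congr (_ ^+ _).
    rewrite (_ : (4 / 5)^-1 = 5 / 4); last by field.
    by congr (_ * _); field.
  apply: lerXn2r; rewrite ?nnegrE; [lra|exact: expR_ge0|].
  have h16 : (1 + 771 / 200 / 16%:R) ^+ 16 <= expR (771 / 200) :> R.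
    by apply: expR_ge_exprn; [|lra].
  by apply: le_trans h16; lra.
- move=> w wB N z lz; rewrite leNgt; apply/negP => wz; apply: wB.
  have [Zz|Zz] := ltP 0 (Z z).
    by apply: (bigsetU_in (p := p) (j := z)); [rewrite /= lz|exists N => //; exact: ltW].
  exfalso; move: wz; apply/negP; rewrite -leNgt.
  have zi i : box_val (z i) = 0 :> R.
    apply/eqP; rewrite -sqrf_eq0; apply/eqP.
    have Z0 : Z z = 0.
      by apply/eqP; rewrite eq_le Zz sumr_ge0// => j _; exact: sqr_ge0.
    by apply: (psumr_eq0P _ Z0) => // j _; exact: sqr_ge0.
  rewrite big1 => [|b _]; last first.
    have -> : \sum_i g i (k + b)%N w * box_val (z i) = 0 :> R.
      by apply: big1 => i _; rewrite zi mulr0.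
    by rewrite expr0n mulr0.
  by rewrite !mulr_ge0 ?(ltW S0)// sumr_ge0// => i _; exact: sqr_ge0.
Qed.

End GaussianMatrixEvents.

(** * Deterministic error analysis *)

Section DeterministicBounds.
Context {R : realType} {n : nat} (G : 'I_n -> nat -> R).

Lemma homogeneous2_sqr m (M : 'I_m -> R) :
  homogeneous2 (fun v : 'I_m -> R => (\sum_i M i * v i) ^+ 2).
Proof.
move=> s v; rewrite -exprMn; congr (_ ^+ 2); rewrite mulr_sumr.
by apply: eq_bigr => i _; rewrite mulrCA.
Qed.

(** With [r = 11] the trace allowance costs [5 / 1936 * n], and [1 / 200 - 5 / 1936 >= 1 / 420]. *)
Lemma head_lower_bound k : (0 < n)%N -> (0 < k)%N ->
  (forall z : {ffun 'I_k -> 'I_(k * 12 + (k * 12).+1)}, l1_le z ->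
    n%:R / 200 * (\sum_j box_val (z j) ^+ 2) <=
    \sum_i (\sum_(j < k) G i j * box_val (z j)) ^+ 2) ->
  \sum_i \sum_(j < k) G i j ^+ 2 <= 5 / 4 * n%:R * k%:R ->
  forall v : 'I_k -> R,
    n%:R / 420 * \sum_j v j ^+ 2 <= \sum_i (\sum_(j < k) G i j * v j) ^+ 2.
Proof.
move=> n0 k0 Gz Gf v.
pose c (j : 'I_k) := \sum_i G i j ^+ 2.
have qf : coordinate_quadratic
    (fun v : 'I_k -> R => \sum_i (\sum_(j < k) G i j * v j) ^+ 2) c.
  by apply: coordinate_quadratic_sum => i; exact: coordinate_quadratic_sqr.
have c0 j : 0 <= c j by apply: sumr_ge0 => i _; exact: sqr_ge0.
have hf : homogeneous2 (fun v : 'I_k -> R => \sum_i (\sum_(j < k) G i j * v j) ^+ 2).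
  by move=> s w; rewrite mulr_sumr; apply: eq_bigr => i _; exact: homogeneous2_sqr.
have K0 : 0 <= n%:R / 200 :> R by apply: divr_ge0; exact: ler0n.
apply: le_trans (lattice_lower_bound k0 (_ : 0 < 11)%N K0 qf c0 hf Gz v) => //.
apply: ler_wpM2r; first by apply: sumr_ge0 => i _; exact: sqr_ge0.
have cE : \sum_j c j <= 5 / 4 * n%:R * k%:R by rewrite exchange_big.
have kR : 0 < k%:R :> R by rewrite ltr0n.
have kR4 : 0 < 4 * k%:R * 11%:R ^+ 2 :> R.
  by apply: mulr_gt0; [apply: mulr_gt0|apply: exprn_gt0].
apply: (@le_trans _ _ (n%:R / 200 - 5 / 4 * n%:R * k%:R / (4 * k%:R * 11%:R ^+ 2))).
  have -> : 5 / 4 * n%:R * k%:R / (4 * k%:R * 11%:R ^+ 2) = 5 / 1936 * n%:R :> R.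
    by field; rewrite gt_eqF.
  have nR : 0 < n%:R :> R by rewrite ltr0n.
  lra.
by rewrite lerD2l lerN2 ler_pM2r// invr_gt0.
Qed.

(** With [r = 4] the constant becomes [64 * (5 / 4) ^ 2 = 100]. *)
Lemma series_upper_bound (k : nat) (s : nat -> R) (S : R) : (0 < n)%N -> 0 <= S ->
  (forall N, forall z : {ffun 'I_n -> 'I_(n * 5 + (n * 5).+1)}, l1_le z ->
   \sum_(b < N) s b ^+ 2 * (\sum_i G i (k + b)%N * box_val (z i)) ^+ 2 <=
   64 * S * \sum_i box_val (z i) ^+ 2) ->
  forall N (v : 'I_n -> R),
   \sum_(b < N) s b ^+ 2 * (\sum_i G i (k + b)%N * v i) ^+ 2 <=
   100 * S * \sum_i v i ^+ 2.
Proof.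
move=> n0 S0 Gz N v.
pose f (v : 'I_n -> R) := \sum_(b < N) s b ^+ 2 * (\sum_i G i (k + b)%N * v i) ^+ 2.
pose c (i : 'I_n) := \sum_(b < N) s b ^+ 2 * G i (k + b)%N ^+ 2.
have qf : coordinate_quadratic f c.
  apply: coordinate_quadratic_sum => b; apply: coordinate_quadraticZ.
  exact: coordinate_quadratic_sqr.
have c0 i : 0 <= c i by apply: sumr_ge0 => b _; apply: mulr_ge0; exact: sqr_ge0.
have hf : homogeneous2 f.
  move=> t w; rewrite mulr_sumr; apply: eq_bigr => b _; rewrite [RHS]mulrCA.
  by congr (_ * _); rewrite (homogeneous2_sqr (fun i => G i (k + b)%N)).
have K0 : 0 <= 64 * S by apply: mulr_ge0.
have := lattice_upper_bound n0 (_ : 0 < 4)%N K0 qf c0 hf (Gz N) v.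
by move=> /(_ isT); rewrite (_ : 64 * S * (5%:R / 4%:R) ^+ 2 = 100 * S)//; field.
Qed.

End DeterministicBounds.

Section LeastSquares.
Context {R : realType} {n k : nat} (psi : 'M[R]_(n, k)) (c : R).
Hypothesis c0 : 0 < c.
Hypothesis psi_ge : forall v : 'cV[R]_k,
  c * \sum_j v j 0 ^+ 2 <= \sum_i (psi *m v) i 0 ^+ 2.

Lemma psi_inj (v : 'cV[R]_k) : psi *m v = 0 -> v = 0.
Proof.
move=> pv; have := psi_ge v; rewrite pv.
rewrite [leRHS]big1 => [h|i _]; last by rewrite mxE expr0n.
have v0 : \sum_j v j 0 ^+ 2 = 0.
  apply/eqP; rewrite eq_le -(ler_pM2l c0) mulr0 h/=.
  by apply: sumr_ge0 => j _; exact: sqr_ge0.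
apply/colP => j; rewrite [RHS]mxE; apply/eqP; rewrite -sqrf_eq0; apply/eqP.
by apply: (psumr_eq0P _ v0) => // i _; exact: sqr_ge0.
Qed.

(** The first Penrose identity says that [psi] kills every column of the difference, and [psi] is
    injective. *)
Lemma mp_inverse_mulVmx : mp_inverse psi *m psi = 1%:M.
Proof.
have [pBp _ _ _] := mp_inverseP psi; apply/eqP; rewrite -subr_eq0; apply/eqP.
apply/matrixP => i j; rewrite [RHS]mxE.
have h := @psi_inj (col j (mp_inverse psi *m psi - 1%:M)).
have /h/colP/(_ i) : psi *m col j (mp_inverse psi *m psi - 1%:M) = 0.
  by rewrite colE mulmxA mulmxBr mulmx1 mulmxA pBp subrr mul0mx.
by rewrite !mxE.
Qed.

Lemma sqr_mxE m (v : 'cV[R]_m) : \sum_i v i 0 ^+ 2 = (v^T *m v) 0 0.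
Proof. by rewrite mxE; apply: eq_bigr => i _; rewrite mxE expr2. Qed.

(** [psi *m mp_inverse psi] is an orthogonal projection, so by Pythagoras it does not increase the
    norm of [w]. *)
Lemma mp_inverse_norm (w : 'cV[R]_n) :
  c * \sum_j (mp_inverse psi *m w) j 0 ^+ 2 <= \sum_i w i 0 ^+ 2.
Proof.
apply: le_trans (psi_ge _) _; rewrite mulmxA.
have [_ BpB pBt _] := mp_inverseP psi; set p := psi *m mp_inverse psi in pBt *.
have pp : p *m p = p by rewrite /p mulmxA -(mulmxA psi) -mulmxA BpB.
move: p pBt pp => p pBt pp.
have h : \sum_i (p *m w) i 0 ^+ 2 + \sum_i (w - p *m w) i 0 ^+ 2 = \sum_i w i 0 ^+ 2.
  have E1 : (p *m w)^T *m (p *m w) = w^T *m (p *m w).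
    by rewrite trmx_mul pBt -mulmxA (mulmxA p p) pp.
  have E2 : (w - p *m w)^T *m (w - p *m w) = w^T *m w - w^T *m (p *m w).
    have -> : (w - p *m w)^T = w^T - (p *m w)^T by rewrite linearB.
    by rewrite mulmxBl !mulmxBr E1 trmx_mul pBt -mulmxA subrr subr0.
  by rewrite !sqr_mxE E1 E2 [X in _ + X]mxE [X in _ + (_ + X)]mxE addrC subrK.
by rewrite -h lerDl sumr_ge0// => i _; exact: sqr_ge0.
Qed.

End LeastSquares.

(** * Points of the ellipsoid and the error of least squares on them *)

Section Ellipsoid.
Context {R : realType}.
Implicit Types x sigma : nat -> R.

Lemma l2normE x : l2norm x = sqrte (\sum_(j <oo) (x j ^+ 2)%:E)%E.
Proof.
rewrite /l2norm Lnorm_counting//.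
rewrite (eq_eseriesr (g := fun j => (x j ^+ 2)%:E)); last first.
  move=> j _; have -> : (`|(EFin \o x) j| = `|x j|%:E)%E by [].
  by rewrite poweR_EFin powR_mulrn// real_normK// num_real.
rewrite poweR12_sqrt//; apply: nneseries_ge0 => j _ _.
by rewrite lee_fin sqr_ge0.
Qed.

Lemma ellipsoid_factor sigma x : (forall j, 0 <= sigma j) ->
  ellipsoid sigma x -> exists2 y : nat -> R,
    forall j, x j = sigma j * y j & forall N, \sum_(j < N) y j ^+ 2 <= 1.
Proof.
move=> s0 [_ /= xs]; pose u j := (((x j)%:E / (sigma j)%:E) ^+ 2)%E.
have u0 j : (0 <= u j)%E by exact: sqre_ge0.
have uN N : (\sum_(0 <= j < N) u j <= 1)%E.
  by apply: le_trans xs; apply: nneseries_lim_ge.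
(* Where [sigma j = 0], a nonzero [x j] would have infinite energy, so the value 0 is consistent. *)
pose y j := if sigma j == 0 then 0 else x j / sigma j.
have uy j : u j = (y j ^+ 2)%:E /\ x j = sigma j * y j.
  rewrite /u /y inver; case: eqVneq => [sj|sj]; last first.
    by rewrite -EFinM EFin_expe; split=> //; rewrite mulrCA mulfV ?mulr1.
  have [xj|xj] := eqVneq (x j) 0; first by rewrite xj mul0e EFin_expe mulr0.
  exfalso; have : (u j <= 1)%E.
    apply: le_trans (uN j.+1); rewrite big_nat_recr//= leeDr//.
    exact: sume_ge0.
  suff -> : u j = +oo%E by [].
  rewrite /u inver sj eqxx expe2; case: (ltgtP (x j) 0) xj => // xj _.
    by rewrite lt0_muley ?lte_fin// mulNyNy.
  by rewrite gt0_muley ?lte_fin// mulyy.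
exists y => [j|N]; first by case: (uy j).
rewrite -lee_fin -sumEFin; apply: le_trans (uN N); rewrite big_mkord.
by apply: lee_sum => j _; case: (uy j) => ->.
Qed.

End Ellipsoid.

(** Makes least squares an admissible mapping in the infimum that defines the radius. *)
Lemma ell2_extend0 {R : realType} k (v : 'cV[R]_k) : ell2 (extend0 v).
Proof.
have sq0 j : (0 <= (extend0 v j ^+ 2)%:E)%E by rewrite lee_fin sqr_ge0.
suff : (\sum_(j <oo) (extend0 v j ^+ 2)%:E <= (\sum_(j < k) v j 0 ^+ 2)%:E)%E.
  move=> h; rewrite /ell2/= /finite_norm -/(l2norm _) l2normE.
  rewrite -ge0_fin_numE ?sqrte_ge0// sqrte_fin_num; last exact: nneseries_ge0.
  by rewrite ge0_fin_numE ?(le_lt_trans h) ?ltry//; exact: nneseries_ge0.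
apply: lime_le; first exact: is_cvg_nneseries.
apply: nearW => N; rewrite big_mkord.
apply: (@le_trans _ _ (\sum_(j < k + N) (extend0 v j ^+ 2)%:E)%E).
  by rewrite addnC big_split_ord/= leeDl// sume_ge0.
rewrite sumEFin lee_fin big_split_ord/= [X in _ + X]big1 ?addr0.
  by apply: ler_sum => j _; rewrite /extend0 (_ : insub (j : nat) = Some j) ?valK.
move=> b _; rewrite /extend0 insubN/= ?expr0n//.
by rewrite -leqNgt leq_addr.
Qed.

Section LeastSquaresError.
Context {R : realType} {n : nat} (G : 'I_n -> nat -> R) (k : nat).
Variables (sigma x : nat -> R) (S D c : R).
Hypothesis sigma_ge0 : forall j, 0 <= sigma j.
Hypothesis S0 : 0 <= S.
Hypothesis sigma_le : forall b, sigma (k + b)%N ^+ 2 <= D.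
Hypothesis series_le : forall N (v : 'I_n -> R),
  \sum_(b < N) sigma (k + b)%N ^+ 2 * (\sum_i G i (k + b)%N * v i) ^+ 2 <=
  S * \sum_i v i ^+ 2.
Hypothesis c0 : 0 < c.
Hypothesis head_ge : forall v : 'I_k -> R,
  c * \sum_j v j ^+ 2 <= \sum_i (\sum_(j < k) G i j * v j) ^+ 2.
Hypothesis xE : ellipsoid sigma x.

Let term i j := G i j * x j.
Let rest i N := \sum_(b < N) term i (k + b)%N.

Lemma ellipsoid_tail : exists2 y : nat -> R,
  forall j, x j = sigma j * y j &
  forall N, \sum_(b < N) y (k + b)%N ^+ 2 <= 1.
Proof.
have [y xy y1] := ellipsoid_factor sigma_ge0 xE; exists y => // N.
apply: le_trans (y1 (k + N)%N); rewrite big_split_ord/= lerDr.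
by apply: sumr_ge0 => j _; exact: sqr_ge0.
Qed.

(** Duality: [series_le] controls the transposed operator. Pairing it with the tail of [y],
    Cauchy-Schwarz gives [U ^+ 2 <= S * U]. *)
Lemma rest_le N : \sum_i rest i N ^+ 2 <= S.
Proof.
have [y xy y1] := ellipsoid_tail.
set U := \sum_i _; have U0 : 0 <= U by apply: sumr_ge0 => i _; exact: sqr_ge0.
have UE : U = \sum_(b < N) y (k + b)%N *
    (sigma (k + b)%N * \sum_i G i (k + b)%N * rest i N).
  rewrite /U; under eq_bigr => i _ do rewrite expr2 {1}/rest mulr_suml.
  rewrite exchange_big/=; apply: eq_bigr => b _; rewrite !mulr_sumr.
  by apply: eq_bigr => i _; rewrite /term xy; ring.
have U2 : U ^+ 2 <= S * U.
  rewrite {1}UE; apply: le_trans (sum_CauchySchwarz _ _ _) _.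
  rewrite -[leRHS]mul1r; apply: ler_pM; last 2 first.
  - exact: y1.
  - by under eq_bigr do rewrite exprMn; exact: series_le.
  - by apply: sumr_ge0 => b _; exact: sqr_ge0.
  - by apply: sumr_ge0 => b _; exact: sqr_ge0.
have [->//|Un0] := eqVneq U 0.
by rewrite -(@ler_pM2r _ U) -?expr2// lt0r Un0.
Qed.

(** Absolute convergence: beyond index [k] a term is at most half of [(sigma * G) ^ 2 + y ^ 2], and
    [series_le] at the [i]-th unit vector bounds the sum of the first squares by [S]. *)
Lemma cvg_information i : cvgn (series (term i)).
Proof.
have [y xy y1] := ellipsoid_tail.
apply: normed_cvg; apply: nondecreasing_is_cvgn.
  by apply: nondecreasing_series => j _ _; exact: normr_ge0.
exists (\sum_(j < k) `|term i j| + (S + 1) / 2) => _ [N _ <-].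
rewrite [leLHS](_ : _ = \sum_(j < N) `|term i j|); last first.
  by rewrite -(big_mkord xpredT (fun j => `|term i j|)).
apply: (@le_trans _ _ (\sum_(j < k + N) `|term i j|)).
  rewrite addnC big_split_ord/= lerDl.
  by apply: sumr_ge0 => j _; exact: normr_ge0.
rewrite big_split_ord/= lerD2l.
apply: (@le_trans _ _ (\sum_(b < N)
   ((sigma (k + b)%N * G i (k + b)%N) ^+ 2 + y (k + b)%N ^+ 2) / 2)).
  apply: ler_sum => b _; rewrite /term xy mulrCA mulrA normrM.
  rewrite ler_pdivlMr// -[X in _ <= X + _]real_normK ?num_real//.
  rewrite -[X in _ <= _ + X]real_normK ?num_real//.
  by have := sqr_ge0 (`|sigma (k + b)%N * G i (k + b)%N| - `|y (k + b)%N|); nra.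
rewrite -mulr_suml ler_pM2r ?invr_gt0// big_split/=; apply: lerD; last exact: y1.
have e1 : \sum_i' (i' == i)%:R ^+ 2 = 1 :> R.
  rewrite (bigD1 i)//= eqxx expr1n big1 ?addr0// => j /negbTE ->.
  by rewrite expr0n.
have := series_le N (fun i' => (i' == i)%:R); rewrite e1 mulr1.
apply: le_trans; apply: ler_sum => b _; rewrite exprMn.
rewrite (bigD1 i)//= eqxx mulr1 big1 ?addr0// => j /negbTE ->.
by rewrite mulr0.
Qed.

Let psi : 'M[R]_(n, k) := \matrix_(i < n, j < k) G i j.
Let B := mp_inverse psi.
Let w : 'cV[R]_n := \col_i limn (series (term i)).
Let xh : 'cV[R]_k := \col_j x j.
Let r : 'cV[R]_n := w - psi *m xh.

Lemma least_squaresE : least_squares k G x = extend0 (B *m w).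
Proof.
rewrite /least_squares; congr (extend0 (_ *m _)); apply/colP => i.
rewrite !mxE ffunE/= asboolT//; exact: cvg_information.
Qed.

Lemma psi_ge (v : 'cV[R]_k) : c * \sum_j v j 0 ^+ 2 <= \sum_i (psi *m v) i 0 ^+ 2.
Proof.
apply: le_trans (head_ge (fun j => v j 0)) _; rewrite le_eqVlt; apply/orP; left.
apply/eqP; apply: eq_bigr => i _; rewrite mxE; congr (_ ^+ 2).
by apply: eq_bigr => j _; rewrite mxE.
Qed.

Lemma residual_le : \sum_i r i 0 ^+ 2 <= S.
Proof.
have rcvg i : rest i N @[N --> \oo] --> r i 0.
  have rE : rest i = (fun N => series (term i) (N + k)%N - \sum_(j < k) term i j).
    apply/funext => N; rewrite /series/= addnC big_mkord big_split_ord/=.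
    by rewrite addrC addrK.
  have rhE : r i 0 = limn (series (term i)) - \sum_(j < k) term i j.
    rewrite /r !mxE; congr (_ - _).
    by apply: eq_bigr => j _; rewrite !mxE.
  rewrite rE rhE; apply: cvgB; last exact: cvg_cst.
  by rewrite (cvg_shiftn k (series (term i))); exact: cvg_information.
apply: (@cvgr_to_le _ \oo _ _ (fun N => \sum_i rest i N ^+ 2)); last first.
  by apply: nearW => N; exact: rest_le.
apply: cvg_big => [|i _]; first exact: add_continuous.
under eq_cvg do rewrite expr2.
by rewrite expr2; apply: cvgM; exact: rcvg.
Qed.

Lemma least_squares_error :
  (l2norm (least_squares k G x \- x)%R <= sqrte (S / c + D)%:E)%E.
Proof.
have [y xy y1] := ellipsoid_tail.
have D0 : 0 <= D by apply: le_trans (sigma_le 0); exact: sqr_ge0.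
rewrite l2normE lee_sqrt; last first.
  by rewrite lee_fin addr_ge0// divr_ge0// ltW.
pose e : nat -> R := least_squares k G x \- x.
have sq0 j : (0 <= (e j ^+ 2)%:E)%E.
  by rewrite lee_fin sqr_ge0.
apply: lime_le; first exact: is_cvg_nneseries.
apply: nearW => N; rewrite big_mkord.
(* As [B *m psi = 1], the head [xh] is reproduced exactly and only the contribution [r] of the tail
   passes through [B]. *)
have BwE : B *m w = xh + B *m r.
  by rewrite /r mulmxBr mulmxA (mp_inverse_mulVmx c0 psi_ge) mul1mx addrC subrK.
apply: (@le_trans _ _ (\sum_(j < k + N) (e j ^+ 2)%:E)%E).
  by rewrite addnC big_split_ord/= leeDl// sume_ge0.
(* The first [k] coordinates of the error contribute at most [S / c]; the others, where the output
   is 0, at most [D]. *)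
rewrite sumEFin lee_fin big_split_ord/=; apply: lerD.
  rewrite (eq_bigr (fun j => (B *m r) j 0 ^+ 2)) => [|j _]; last first.
    rewrite /e least_squaresE /= /extend0.
    rewrite (_ : insub (j : nat) = Some j) /=; last exact: valK.
    rewrite BwE; congr (_ ^+ 2).
    by rewrite mxE [xh j 0]mxE addrAC subrr add0r.
  rewrite ler_pdivlMr// mulrC; apply: le_trans residual_le.
  exact: (mp_inverse_norm psi_ge).
rewrite (eq_bigr (fun b : 'I_N => sigma (k + b)%N ^+ 2 * y (k + b)%N ^+ 2)); last first.
  move=> b _; rewrite /e least_squaresE /= /extend0 insubN/= ?sub0r ?sqrrN ?xy ?exprMn//.
  by rewrite -leqNgt leq_addr.
apply: (@le_trans _ _ (\sum_(b < N) D * y (k + b)%N ^+ 2)).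
  by apply: ler_sum => b _; rewrite ler_wpM2r ?sqr_ge0.
by rewrite -mulr_sumr -[leRHS]mulr1 ler_wpM2l.
Qed.

End LeastSquaresError.

(** * Tail sums of the squares of [sigma] *)

Section TailSum.
Context {R : realType} (sigma : nat -> R) (n : nat).
Hypothesis sigma2 : ell2 sigma.
Hypothesis sigma0 : forall j, 0 <= sigma j.
Hypothesis sigma_noninc : forall i j, (i <= j)%N -> sigma j <= sigma i.
Hypothesis n4 : (4 <= n)%N.

Let tail : \bar R := (\sum_(j <oo | (n %/ 4 <= j.+1)%N) ((sigma j) ^+ 2)%:E)%E.

Lemma tail_fin_num : tail \is a fin_num.
Proof.
have sq0 j : (0 <= (sigma j ^+ 2)%:E)%E by rewrite lee_fin sqr_ge0.
have full0 : (0 <= \sum_(j <oo) (sigma j ^+ 2)%:E)%E by exact: nneseries_ge0.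
rewrite ge0_fin_numE; last exact: nneseries_ge0.
apply: (@le_lt_trans _ _ (\sum_(j <oo) (sigma j ^+ 2)%:E)%E).
  exact: subset_lee_nneseries.
rewrite -ge0_fin_numE// -sqrte_fin_num// ge0_fin_numE ?sqrte_ge0//.
by have : (l2norm sigma < +oo)%E := sigma2; rewrite l2normE.
Qed.

Lemma tail_ge N : \sum_(0 <= j < N | (n %/ 4 <= j.+1)%N) sigma j ^+ 2 <= fine tail.
Proof.
rewrite -lee_fin fineK ?tail_fin_num// -sumEFin; apply: nneseries_lim_ge => j _ _.
by rewrite lee_fin sqr_ge0.
Qed.

Lemma tail_block_le N :
  \sum_(b < N) sigma (n %/ 2 + b)%N ^+ 2 <= fine tail.
Proof.
apply: le_trans (tail_ge (n %/ 2 + N)%N).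
rewrite [leRHS]big_mkcond big_mkord big_split_ord/=; apply: ler_wpDl.
  by apply: sumr_ge0 => j _; case: (n %/ 4 <= j.+1)%N; rewrite ?sqr_ge0.
apply: ler_sum => b _; rewrite ifT//.
by lia.
Qed.

Lemma tail_entry_le b : sigma (n %/ 2 + b)%N ^+ 2 <= 4 * fine tail / n%:R.
Proof.
have nR : 0 < n%:R :> R by rewrite ltr0n; lia.
rewrite ler_pdivlMr//.
(* Counts the 0-based indices from [(n %/ 4).-1], where the tail starts, through [n %/ 2]; the
   entries there are at least [sigma (n %/ 2)]. *)
pose m := ((n %/ 2).+1 - (n %/ 4).-1)%N.
have nm : n%:R <= 4 * m%:R :> R by rewrite -natrM ler_nat /m; lia.
have bk : sigma (n %/ 2 + b)%N ^+ 2 <= sigma (n %/ 2)%N ^+ 2.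
  by rewrite ler_sqr ?nnegrE// sigma_noninc// leq_addr.
apply: (@le_trans _ _ (4 * (sigma (n %/ 2)%N ^+ 2 *+ m))).
  rewrite -[_ ^+ 2 *+ m]mulr_natl mulrA [leLHS]mulrC.
  by apply: ler_pM; [exact: ler0n|exact: sqr_ge0|exact: nm|exact: bk].
rewrite ler_pM2l//; apply: le_trans (tail_ge (n %/ 2).+1).
rewrite (@big_cat_nat _ 0 +%R (n %/ 4).-1)//=; last by lia.
rewrite ler_wpDl//; first by apply: sumr_ge0 => j _; exact: sqr_ge0.
have -> : \sum_((n %/ 4).-1 <= j < (n %/ 2).+1 | (n %/ 4 <= j.+1)%N) sigma j ^+ 2 =
    \sum_((n %/ 4).-1 <= j < (n %/ 2).+1) sigma j ^+ 2.
  by rewrite big_nat_cond [RHS]big_nat_cond; apply: eq_bigl => j; apply/idP/idP; lia.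
rewrite /m -sumr_const_nat; apply: ler_sum_nat => j jk.
by rewrite ler_sqr ?nnegrE// sigma_noninc//; lia.
Qed.

End TailSum.

(** * Combination of the exceptional events with the deterministic bound *)

Theorem theorem3 (R : realType) (d : measure_display) (T : measurableType d)
    (P : probability T R) (n : nat) (g : 'I_n -> nat -> {RV P >-> R})
    (sigma : nat -> R) :
  (0 < n)%N ->
  ell2 sigma ->
  (forall j, 0 <= sigma j) ->
  (forall i j, (i <= j)%N -> sigma j <= sigma i) ->
  gaussian_matrix g ->
  exists E : set T,
    [/\ measurable E,
        ((1 - 2 * expR (- (n%:R / 100)))%:E <= P E)%E &
        forall w, E w ->
          let G i j := g i j w in
          let e := worst_case_error sigma (least_squares (n %/ 2) G) in
          (information_radius sigma G <= e)%E /\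
          (e <= (221 / Num.sqrt n%:R)%:E *
                sqrte (\sum_(j <oo | (n %/ 4 <= j.+1)%N) ((sigma j) ^+ 2)%:E))%E].
Proof.
move=> n0 s2 s0 sN gg.
(* In the first case the claimed probability is at most 0 and the empty event suffices. *)
have [e_ge|e_lt] := leP (1 / 2) (expR (- (n%:R / 100)) : R).
  by exists set0; split => //; rewrite measure0 lee_fin; lra.
(* From [1 - n / 100 <= expR (- (n / 100)) < 1 / 2]. *)
have n50 : (50 <= n)%N.
  rewrite -(ler_nat R); have := expR_ge1Dx (- (n%:R / 100) : R); lra.
have n4 : (4 <= n)%N by apply: leq_trans n50.
have k0 : (0 < n %/ 2)%N by lia.
set tail := (\sum_(j <oo | _) _)%E.
have tail0 : (0 <= tail)%E.
  by apply: nneseries_ge0 => j _ _; rewrite lee_fin sqr_ge0.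
have tailE : (fine tail)%:E = tail by rewrite fineK// tail_fin_num.
have S0 : 0 <= fine tail by exact: fine_ge0.
have entry_le := tail_entry_le s2 s0 sN n4.
have [B1 [mB1 PB1 head_ok]] := head_event gg n50.
have [B2 [mB2 PB2 frob_ok]] := frobenius_event gg n50.
have [B3 [mB3 PB3 series_ok]] := series_event gg S0 entry_le (tail_block_le s2 n4).
have mB : measurable (B1 `|` B2 `|` B3) by apply: measurableU => //; exact: measurableU.
exists (~` (B1 `|` B2 `|` B3)); split; first exact: measurableC.
  rewrite probability_setC//.
  set t := expR _ in e_lt *; pose t2 : R := expR (- (n%:R / 50)).
  (* Three events of probability at most [t ^+ 2] fit below [2 * t] because [t < 1 / 2]. *)
  have t2E : t2 = t ^+ 2 by rewrite -expRM_natr; congr expR; field.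
  have PB : (P (B1 `|` B2 `|` B3) <= (t2 + t2 + t2)%:E)%E.
    rewrite !EFinD; apply: le_trans (measureU2 _ _ mB3) _; first exact: measurableU.
    apply: leeD => //; apply: le_trans (measureU2 _ mB1 mB2) _; exact: leeD.
  apply: (@le_trans _ _ (1 - (t2 + t2 + t2)%:E)%E); last exact: leeB.
  rewrite -EFinB lee_fin t2E; have t0 : 0 < t by exact: expR_gt0.
  by nra.
move=> w /not_orP[/not_orP[w1 w2] w3] G e; split.
  (* Least squares uses [x] only through its information, so it is one of the competing mappings. *)
  apply: ereal_inf_lbound; exists (fun o : {ffun 'I_n -> option R} =>
    extend0 (mp_inverse (\matrix_(i < n, j < n %/ 2) G i j) *m \col_i odflt 0 (o i))).
    by move=> x _; exact: ell2_extend0.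
  by [].
have nR : 0 < n%:R :> R by rewrite ltr0n.
have head_ge := head_lower_bound (G := G) n0 k0 (head_ok w w1) (frob_ok w w2).
have series_le := series_upper_bound (G := G)
  (s := fun b => sigma (n %/ 2 + b)%N) n0 S0 (series_ok w w3).
have c0 : 0 < n%:R / 420 :> R by apply: divr_gt0; [exact: nR|rewrite ltr0n].
apply: ge_ereal_sup => _ [x xE <-].
apply: le_trans (least_squares_error s0 _ entry_le series_le c0 head_ge xE) _.
  by apply: mulr_ge0.
rewrite -/tail -tailE -EFinM lee_fin.
have tn0 : 0 <= fine tail / n%:R by apply: divr_ge0 => //; exact: ltW.
have -> : 221 / Num.sqrt n%:R * Num.sqrt (fine tail) =
    Num.sqrt (221 ^+ 2 * (fine tail / n%:R)) :> R.
  rewrite sqrtrM ?sqr_ge0// sqrtr_sqr ger0_norm ?ler0n//.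
  by rewrite sqrtrM// sqrtrV ?(ltW nR)// mulrAC mulrA.
apply: ler_wsqrtr.
have -> : 100 * fine tail / (n%:R / 420) + 4 * fine tail / n%:R =
    (100 * 420 + 4) * (fine tail / n%:R) by field; rewrite gt_eqF.
apply: ler_wpM2r => //; lra.
Qed.
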